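(* Let $X$ be a Polish space, $\Omega=C([0,+\infty)\to X)$, and let $\mathscr{P}$ be the space of Borel probability measures on $\Omega$. Every Krylov set-valued map $\mathscr{C}:X\to2^{\mathscr{P}}$ has a Markov selection, i.e. there is a measurable selection $x\mapsto P_x\in\mathscr{C}(x)$ such that for every $x\in X$ and every $s>0$, $$\theta_sP_x(\cdot)=\int_\Omega P_{w(s)}(\cdot)\,P_x(dw).$$
   Context: $\Omega$ is the space of continuous paths $w:[0,+\infty)\to X$ with the compact-open topology; $\Omega_x=\{w\in\Omega:w(0)=x\}$; $\theta_s w(\cdot)=w(s+\cdot)$, and $\theta_sP$ is the push-forward of $P\in\mathscr{P}$ under $\theta_s$. $\mathscr{P}$ carries the weak (weak$^*$) topology generated by $P\mapsto Pf=\int f\,dP$, $f\in C_b(\Omega)$ (bounded continuous functions). Fix a countable family $\Phi$ of bounded continuous functions on $X$ that is closed under multiplication and strongly separates points of $X$ (for every $x\in X$ and every neighbourhood $O$ of $x$ there are $g_1,\dots,g_k\in\Phi$ with $\inf_{y\notin O}\max_{l}|g_l(y)-g_l(x)|>0$), a countable dense subset $\Lambda$ of $(0,+\infty)$, and an enumeration $(\lambda_n,\varphi_n)$, $n\ge1$, of $\Lambda\times\Phi$. For $s>0$ put $$\zeta_n^s(P)=\int_0^s e^{-\lambda_nt}\int_\Omega\varphi_n(w(t))\,P(dw)\,dt .$$ For a set-valued map $\mathscr{C}$, let $h_x[f]=\sup\{Pf:P\in\mathscr{C}(x)\}$ be the support function of $\mathscr{C}(x)$, $f\in C_b(\Omega)$.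 For $P\in\mathscr{P}$ and $s\ge 0$ let $$K(P,s,\mathscr{C})=\Big\{Q\in\mathscr{P}:\ Qf\le\int_\Omega h_{w(s)}[f]\,P(dw)\ \ \forall f\in C_b(\Omega)\Big\},$$ and for $x\in X$, $P\in\mathscr{C}(x)$, $s>0$ let $$\Gamma[P,x,s](\mathscr{C})=\{Q\in\mathscr{C}(x):\ \theta_sQ\in K(P,s,\mathscr{C})\ \text{and}\ \zeta_n^s(Q)\ge\zeta_n^s(P)\ \ \forall n\ge1\}.$$ $\mathscr{C}:X\to2^{\mathscr{P}}$ is a Krylov map if: (C1) each $\mathscr{C}(x)$ is a non-empty compact convex subset of $\mathscr{P}$; (C2) $\{x\in X:\mathscr{C}(x)\cap K\ne\emptyset\}$ is Borel in $X$ for every closed $K\subset\mathscr{P}$; (C3) $P(\Omega_x)=1$ for every $P\in\mathscr{C}(x)$, $x\in X$; (KP1) for all $x\in X$, $s>0$, if $P\in\mathscr{C}(x)$ then $\theta_sP\in K(P,s,\mathscr{C})$; (KP2) for all $x\in X$, $s>0$, if $P\in\mathscr{C}(x)$ then $\theta_s\big(\Gamma[P,x,s](\mathscr{C})\big)=K(P,s,\mathscr{C})$, where $\theta_s(\Gamma)=\{\theta_sQ:Q\in\Gamma\}$. A measurable selection is a Borel measurable map $x\mapsto P_x\in\mathscr{P}$ with $P_x\in\mathscr{C}(x)$ for all $x$. *)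

(* Defs.v *)
From HB Require Import structures.
From mathcomp Require Import all_boot all_order all_algebra.
From mathcomp Require Import all_classical all_reals all_analysis.

Set Implicit Arguments.
Unset Strict Implicit.
Unset Printing Implicit Defensive.

Import Order.TTheory GRing.Theory Num.Theory.
Import numFieldTopology.Exports numFieldNormedType.Exports.

Local Open Scope classical_set_scope.
Local Open Scope ring_scope.

Definition separable_space (T : topologicalType) : Prop :=
  exists2 D : set T, countable D & dense D.

Definition completely_metrizable (R : realType) (T : topologicalType) : Prop :=
  exists d : T -> T -> R,
    [/\ [/\ forall x y, 0 <= d x y,
            forall x y, d x y = 0 <-> x = y,
            forall x y, d x y = d y x &
            forall x y z, d x z <= d x y + d y z],
        forall (x : T) (A : set T),
          nbhs x A <-> exists2 e : R, 0 < e & [set y | d x y < e] `<=` A &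
        forall u : nat -> T,
          (forall e : R, 0 < e -> exists N : nat, forall m n : nat,
             (N <= m)%N -> (N <= n)%N -> d (u m) (u n) < e) ->
          exists l : T, u @ \oo --> l].

Definition polish (R : realType) (T : topologicalType) : Prop :=
  separable_space T /\ completely_metrizable R T.

Definition borel (T : ptopologicalType) := g_sigma_algebraType (@open T).

Definition Cb (R : realType) (T : topologicalType) : set (T -> R) :=
  [set f | continuous f /\ [bounded f x | x in [set: T]]].

(* A [probability] is a function on all subsets whose values outside the
   sigma-algebra are unconstrained.  They are normalised to 0 in [law], so that
   two laws are equal as soon as they agree on the Borel sets. *)
Record law (R : realType) (T : ptopologicalType) := Law {
  law_prob :> probability (borel T) R ;
  law_out : forall A : set (borel T), ~ measurable A -> law_prob A = 0%E }.

Section law_of.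
Local Open Scope ereal_scope.
Context (R : realType) (T : ptopologicalType) (P : probability (borel T) R).

Definition borel_part (A : set (borel T)) : \bar R :=
  if `[< measurable A >] then P A else 0.

Lemma borel_partE A : measurable A -> borel_part A = P A.
Proof. by move=> mA; rewrite /borel_part; case: asboolP. Qed.

Let borel_part0 : borel_part set0 = 0.
Proof. by rewrite borel_partE. Qed.

Let borel_part_ge0 A : 0 <= borel_part A.
Proof. by rewrite /borel_part; case: ifP. Qed.

Let borel_part_sigma_additive : semi_sigma_additive borel_part.
Proof.
move=> F mF tF mUF; rewrite borel_partE//.
rewrite (_ : (fun n => _) = (fun n => \sum_(0 <= i < n) P (F i))).
  exact: measure_semi_sigma_additive.
by apply/funext => n; apply: eq_bigr => i _; rewrite borel_partE.
Qed.

HB.instance Definition _ := isMeasure.Build _ _ _ borel_part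
  borel_part0 borel_part_ge0 borel_part_sigma_additive.

Let borel_partT : borel_part [set: borel T] = 1.
Proof. by rewrite borel_partE// probability_setT. Qed.

HB.instance Definition _ :=
  Measure_isProbability.Build _ _ _ borel_part borel_partT.

Lemma borel_part_out (A : set (borel T)) : ~ measurable A -> borel_part A = 0.
Proof. by move=> mA; rewrite /borel_part; case: asboolP. Qed.

Definition law_of : law R T := Law borel_part_out.

End law_of.

Lemma law_eqP (R : realType) (T : ptopologicalType) (P Q : law R T) :
  (forall A : set (borel T), measurable A -> P A = Q A) <-> P = Q.
Proof.
split=> [PQ|-> //]; case: P Q PQ => [P oP] [Q oQ] /= PQ.
have eqPQ : P = Q.
  have PQf : (P : set (borel T) -> \bar R) = Q.
    apply/funext => A; have [mA|mA] := pselect (measurable A).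
      exact: PQ.
    by rewrite oP// oQ.
  clear PQ oP oQ; case: P Q PQf => [P cP] [Q cQ] /= PQf.
  subst Q; congr (Probability.Pack _).
  case: cP cQ => [[a1 a2] [a3] [a4] [a5] [a6] [a7] [a8]].
  move=> [[b1 b2] [b3] [b4] [b5] [b6] [b7] [b8]].
  rewrite (Prop_irrelevance a1 b1) (Prop_irrelevance a2 b2).
  rewrite (Prop_irrelevance a3 b3) (Prop_irrelevance a4 b4).
  rewrite (Prop_irrelevance a5 b5) (Prop_irrelevance a6 b6).
  by rewrite (Prop_irrelevance a7 b7) (Prop_irrelevance a8 b8).
by subst Q; congr Law; exact: Prop_irrelevance.
Qed.

HB.instance Definition _ (R : realType) (T : ptopologicalType) :=
  gen_eqMixin (law R T).
HB.instance Definition _ (R : realType) (T : ptopologicalType) :=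
  gen_choiceMixin (law R T).
HB.instance Definition _ (R : realType) (T : ptopologicalType) :=
  isPointed.Build (law R T) (law_of point).

Definition law_mean (R : realType) (T : ptopologicalType) (P : law R T)
  (f : T -> R) : R := (\int[P]_w f w)%R.

(* the weak topology: the coarsest one making P |-> Pf continuous, f in Cb *)
HB.instance Definition _ (R : realType) (T : ptopologicalType) :=
  Topological.copy (law R T)
    (initial_topology
      ((fun P f => law_mean P (\val f)) : law R T -> {ptws @Cb R T -> R})).

Definition convex_laws (R : realType) (T : ptopologicalType)
    (C : set (law R T)) : Prop :=
  forall (P Q S : law R T) (t : R), C P -> C Q -> 0 <= t <= 1 ->
    (forall A : set (borel T), measurable A ->
       S A = (t%:E * P A + (1 - t)%:E * Q A)%E) ->
    C S.

Definition time (R : realType) : Type := (`[0, +oo[%classic : set R).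
HB.instance Definition _ (R : realType) := Topological.on (time R).

Lemma max0_time (R : realType) (r : R) : Num.max 0 r \in (`[0, +oo[%classic : set R).
Proof. by rewrite inE/= in_itv/= andbT le_max lexx. Qed.

(* the max makes this total; it is only ever used for r >= 0 *)
Definition to_time (R : realType) (r : R) : time R :=
  exist _ (Num.max 0 r) (max0_time r).

Definition time_add (R : realType) (s t : time R) : time R :=
  to_time (\val s + \val t).

Lemma time_addE (R : realType) (s t : time R) :
  \val (time_add s t) = \val s + \val t.
Proof.
have ge0 (u : time R) : 0 <= \val u.
  by case: u => u /=; rewrite inE /= in_itv /= andbT.
by apply: max_r; apply: addr_ge0; exact: ge0.
Qed.

Lemma time_add_continuous (R : realType) (s : time R) :
  continuous (time_add s).
Proof.
have cval : continuous (set_val : time R -> R).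
  exact: (@initial_continuous _ _ (set_val : `[0, +oo[%classic -> R)).
apply: (@continuous_comp_initial _ _ _
  (set_val : `[0, +oo[%classic -> R) (time_add s)).
rewrite (_ : _ \o _ = fun u : time R => \val s + set_val u); last first.
  by apply/funext => u; rewrite /= !set_valE time_addE.
move=> t; apply: (@cvgD _ _ _ (nbhs t)); [exact: cvg_cst|exact: cval].
Qed.

HB.instance Definition _ (R : realType) (s : time R) :=
  isContinuous.Build _ _ (time_add s) (@time_add_continuous R s).

(* a copy of [continuousType], which has no canonical topology, in order to
   attach the compact-open one *)
Definition path_space (R : realType) (X : ptopologicalType) : Type :=
  continuousType (time R) X.

HB.instance Definition _ (R : realType) (X : ptopologicalType) :=
  Choice.on (path_space R X).
HB.instance Definition _ (R : realType) (X : ptopologicalType) :=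
  isPointed.Build (path_space R X) (cst point : continuousType (time R) X).

Definition path_fun (R : realType) (X : ptopologicalType) (w : path_space R X) :
  time R -> X := (w : continuousType (time R) X).
Coercion path_fun : path_space >-> Funclass.

HB.instance Definition _ (R : realType) (X : ptopologicalType) :=
  Topological.copy (path_space R X)
    (initial_topology
      (@path_fun R X : path_space R X -> {compact-open, time R -> X})).

Definition shift_path (R : realType) (X : ptopologicalType) (s : time R)
  (w : path_space R X) : path_space R X :=
  ((w : continuousType (time R) X) \o time_add s : continuousType _ _).

Lemma shiftE (R : realType) (X : ptopologicalType) (s t : time R)
  (w : path_space R X) : shift_path s w t = w (time_add s t).
Proof. by []. Qed.

Lemma shift_continuous (R : realType) (X : ptopologicalType) (s : time R) :
  continuous (@shift_path R X s).
Proof.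
apply: (@continuous_comp_initial _ _ {compact-open, time R -> X} (@path_fun R X)
  (shift_path s)) => w.
apply/compact_open_cvgP; first by apply: fmap_filter; exact: nbhs_filter.
move=> K O cK oO KO.
have cK' : compact (time_add s @` K).
  by apply: continuous_compact => //; apply/continuous_subspaceT/time_add_continuous.
have oW := compact_open_open cK' oO.
have nw : nbhs w (@path_fun R X @^-1` [set g | g @` (time_add s @` K) `<=` O]).
  apply: open_nbhs_nbhs; split; first by exists [set g | g @` (time_add s @` K) `<=` O].
  by move=> _ [_ [t Kt <-] <-]; apply: KO; exists t.
apply: filterS nw => v vO _ [t Kt <-] /=.
by apply: vO; exists (time_add s t) => //; exists t.
Qed.

Definition borel_shift_path (R : realType) (X : ptopologicalType) (s : time R) :
  borel (path_space R X) -> borel (path_space R X) := @shift_path R X s.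

Lemma shift_measurable (R : realType) (X : ptopologicalType) (s : time R) :
  measurable_fun [set: borel (path_space R X)] (borel_shift_path s).
Proof.
apply: (@measurability _ _ (borel (path_space R X)) (borel (path_space R X)) setT
  (@shift_path R X s) (@open (path_space R X))) => // _ [B oB <-].
rewrite setTI; apply: sub_gen_smallest.
by apply: open_comp => // w _; exact: shift_continuous.
Qed.

HB.instance Definition _ (R : realType) (X : ptopologicalType) (s : time R) :=
  isMeasurableFun.Build _ _ _ _ (@borel_shift_path R X s) (@shift_measurable R X s).

Definition shift_law (R : realType) (X : ptopologicalType) (s : time R)
  (P : law R (path_space R X)) : law R (path_space R X) :=
  law_of (distribution P (@borel_shift_path R X s)).

Lemma shift_lawE (R : realType) (X : ptopologicalType) (s : time R)
  (P : law R (path_space R X)) (A : set (borel (path_space R X))) :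
  measurable A -> shift_law s P A = P (shift_path s @^-1` A).
Proof. exact: borel_partE. Qed.

Definition strongly_separates_points (R : realType) (X : topologicalType)
    (Phi : set (X -> R)) : Prop :=
  forall (x : X) (O : set X), nbhs x O ->
    exists (k : nat) (g : 'I_k.+1 -> X -> R), (forall l, Phi (g l)) /\
      (0 < ereal_inf
        [set (\big[Num.max/0]_(l < k.+1) `|g l y - g l x|)%:E | y in ~` O])%E.

Section krylov.
Context (R : realType) (X : ptopologicalType).
Local Notation Omega := (path_space R X).
Implicit Types (C : X -> set (law R Omega)) (P Q : law R Omega) (s : time R).

Definition zeta (lambda : R) (phi : X -> R) s P : R :=
  (\int[lebesgue_measure]_(t in `[0%R, \val s])
     (expR (- lambda * t) * law_mean P (fun w => phi (w (to_time t)))))%R.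

Definition support_fun C (x : X) (f : Omega -> R) : R :=
  sup [set law_mean P f | P in C x].

(* [Rintegral] is total; under [krylov_C1] and [krylov_C2] the integrand
   is bounded and Borel, because x |-> support_fun C x f then is. *)
Definition Kset P s C : set (law R Omega) :=
  [set Q | forall f : Omega -> R, Cb f ->
     law_mean Q f <= law_mean P (fun w => support_fun C (w s) f)].

Definition Gammaset (lam : nat -> R) (phi : nat -> X -> R) P (x : X) s C :
    set (law R Omega) :=
  [set Q | [/\ C x Q, Kset P s C (shift_law s Q) &
     forall n, zeta (lam n) (phi n) s P <= zeta (lam n) (phi n) s Q]].

Record krylov_map (lam : nat -> R) (phi : nat -> X -> R) C : Prop := KrylovMap {
  krylov_C1 : forall x, [/\ C x !=set0, compact (C x) & convex_laws (C x)] ;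
  krylov_C2 : forall F : set (law R Omega), closed F ->
    measurable ([set x | C x `&` F !=set0] : set (borel X)) ;
  krylov_C3 : forall x P, C x P ->
    P [set w | (w : Omega) (to_time 0) = x] = 1%E ;
  krylov_KP1 : forall x s P, 0 < \val s -> C x P -> Kset P s C (shift_law s P) ;
  krylov_KP2 : forall x s P, 0 < \val s -> C x P ->
    shift_law s @` Gammaset lam phi P x s C = Kset P s C }.

Definition measurable_selection C (p : X -> law R Omega) : Prop :=
  measurable_fun [set: borel X] (p : borel X -> borel (law R Omega)) /\
  forall x, C x (p x).

Definition markov_family (p : X -> law R Omega) : Prop :=
  forall (x : X) (s : time R), 0 < \val s ->
    forall A : set (borel Omega), measurable A ->
      shift_law s (p x) A = (\int[p x]_w p ((w : Omega) s) A)%E.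

End krylov.

(* Main.v *)
Require Import Defs.
From HB Require Import structures.
From mathcomp Require Import all_boot all_order all_algebra.
From mathcomp Require Import all_classical all_reals all_analysis.
From mathcomp Require Import measurable_realfun giry ring lra.
Import Order.TTheory GRing.Theory Num.Theory.
Import numFieldTopology.Exports numFieldNormedType.Exports.

Set Implicit Arguments.
Unset Strict Implicit.
Unset Printing Implicit Defensive.

Local Open Scope classical_set_scope.
Local Open Scope ring_scope.

(* Among the laws of [C x], maximize successively the Laplace functionals
   [P |-> int_0^oo exp (- lam_n t) P(phi_n(w_t)) dt], n = 0, 1, 2, ...; by compactness
   the set [Cinf x] of lexicographic maximizers is non-empty.  All its elements have
   the same one-dimensional marginals, because Laplace transforms are injective and
   the [phi_n] determine laws on [X].

   For [P] in [Cinf x], mix a measurable selection of [Cinf] over [w(s)] under [P].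
   By (KP2) the mixture is the shift of some [Q] in [C x] whose functionals on [0, s]
   dominate those of [P].  Induction on [n] shows that [P] and [Q] tie in every
   coordinate, and that the (KP1) bound on the shift of [P] by support functions of
   [C] improves to support functions of [Cinf].  Applied to products of functions of
   the path at finitely many times, the improved bound turns equality of
   one-dimensional marginals into equality of all finite-dimensional ones, so
   [Cinf x] is a singleton.  Measurability of the selection is then inherited from
   (C2), and the improved bound, applied to [f] and [- f], is the Markov property. *)

(** * A monotone class theorem *)

(** The obstacle is that (KP1) and (KP2) speak of means and support functions, never of conditional
    laws. A bound by a support function becomes an identity only for functions that have the same
    mean under all laws of the set, so the set has to shrink until enough functions are of this
    kind. Laplace functionals are maximized because the integral splits at [s] into [zeta] and
    [exp (- lam_n s)] times the same functional of the shifted law. A law can then be compared with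
    a competitor whose future after [s] has been replaced, without conditioning on the past. The
    mixture requires a measurable selection before the maximizer is known to be unique. It comes
    from a second lexicographic maximization, of the means of countably many cylinder functions,
    which reduces a compact-valued map to a single-valued one and preserves measurability in the
    sense of (C2). *)

Section monotone_class.
Context {R : realType} {T : Type}.
Implicit Types (E M : set (T -> R)) (f g : T -> R).

Definition bounded_fun f := exists B, forall x, `|f x| <= B.

Definition bounded_limit_closed E := forall (f_ : nat -> T -> R) f B,
  (forall n, E (f_ n)) -> (forall n x, `|f_ n x| <= B) ->
  (forall x, f_ n x @[n --> \oo] --> f x) -> E f.

Lemma bounded_fun_cst c : bounded_fun (fun=> c).
Proof. by exists `|c|. Qed.

Lemma bounded_funD f g : bounded_fun f -> bounded_fun g ->
  bounded_fun (fun x => f x + g x).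
Proof.
move=> [B fB] [D gD]; exists (B + D) => x.
by rewrite (le_trans (ler_normD _ _))// lerD.
Qed.

Lemma bounded_funM f g : bounded_fun f -> bounded_fun g ->
  bounded_fun (fun x => f x * g x).
Proof.
by move=> [B fB] [D gD]; exists (B * D) => x; rewrite normrM ler_pM.
Qed.

Lemma bounded_fun_limit (f_ : nat -> T -> R) f B :
  (forall n x, `|f_ n x| <= B) -> (forall x, f_ n x @[n --> \oo] --> f x) ->
  forall x, `|f x| <= B.
Proof.
move=> fB fc x; have /cvg_norm h := fc x.
apply: (@closed_cvg _ _ _ _ (fun n => `|f_ n x|) [set y | y <= B]) h.
  exact: closed_le.
by near=> n; exact: fB.
Unshelve. all: by end_near. Qed.

End monotone_class.

Section half_indicator.
Context {R : realType}.

Lemma bernoulli_ge (x : R) (n : nat) : - 1 <= x -> 1 + n%:R * x <= (1 + x) ^+ n.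
Proof.
move=> x1; elim: n => [|n IHn]; first by rewrite mul0r addr0 expr0.
have x10 : 0 <= 1 + x by rewrite -lerBlDl sub0r.
rewrite exprS; apply: le_trans (ler_wpM2l x10 IHn).
rewrite -subr_ge0 (_ : _ - _ = n%:R * (x * x)); last by rewrite -natr1; ring.
by rewrite mulr_ge0// -expr2 sqr_ge0.
Qed.

(** With [r = t ^+ 2], one factor [t ^+ n] absorbs [n], by Bernoulli's inequality for
    [t^-1 = 1 + d], and the other tends to 0. *)
Lemma cvg_natmul_expr (r : R) : 0 <= r < 1 -> n%:R * r ^+ n @[n --> \oo] --> (0 : R).
Proof.
move=> /andP[r0 r1].
have [->|rn0] := eqVneq r 0.
  apply: cvg_near_cst; near=> n; rewrite expr0n gtn_eqF ?mulr0//.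
  by near: n; exact: nbhs_infty_gt.
have rp : 0 < r by rewrite lt_neqAle eq_sym rn0.
pose t := Num.sqrt r.
have t0 : 0 < t by rewrite sqrtr_gt0.
have tt : t ^+ 2 = r by rewrite sqr_sqrtr.
have t1 : t < 1 by rewrite -(@expr_lt1 _ 2)// ?tt// ltW.
pose d := t^-1 - 1.
have d0 : 0 < d by rewrite subr_gt0 invf_gt1.
have tn n : n%:R * t ^+ n <= d^-1.
  have := @bernoulli_ge d n; rewrite (_ : 1 + d = t^-1); last by rewrite /d; ring.
  rewrite exprVn (le_trans _ (ltW d0))// => /(_ isT) h.
  rewrite -(ler_pM2r (x := d))// mulVf ?gt_eqF// mulrAC.
  rewrite -ler_pdivlMr ?exprn_gt0// mul1r; apply: le_trans h.
  by rewrite lerDr.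
apply: (@squeeze_cvgr _ _ _ _ (fun=> 0) (fun n => d^-1 * t ^+ n)).
- near=> n; rewrite mulr_ge0 ?exprn_ge0//=.
  by rewrite -tt -exprM mul2n -addnn exprD mulrA ler_pM2r// exprn_gt0.
- exact: cvg_cst.
- have := @cvg_geometric R d^-1 t; apply.
  by rewrite ger0_norm// ltW.
Unshelve. all: by end_near. Qed.

(* By Bernoulli's inequality these polynomials converge on [0, 1] to the indicator
   of [y < 1/2]; the factor [n] in the exponent settles the case [y = 1/2]. *)
Definition half_poly n (y : R) : R := (1 - y ^+ n) ^+ (n * 2 ^ n).

Lemma half_poly_itv n (y : R) : 0 <= y <= 1 -> 0 <= half_poly n y <= 1.
Proof.
move=> /andP[y0 y1].
have z0 : 0 <= 1 - y ^+ n by rewrite subr_ge0 exprn_ile1.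
by rewrite exprn_ge0//= exprn_ile1// lerBlDr lerDl exprn_ge0.
Qed.

(** Let [N = n 2^n], so that [N y^n = n (2 y)^n]. If [y < 1/2] this tends to 0, and Bernoulli bounds
    the polynomial below by one minus it. If [y >= 1/2], multiply by [(1 + y^n)^N]: the product is
    at most 1, while this factor is at least [n + 1]. *)
Lemma half_poly_cvg (y : R) : 0 <= y <= 1 ->
  half_poly n y @[n --> \oo] --> ((y < 2^-1)%R%:R : R).
Proof.
move=> /andP[y0 y1].
have yn1 n : y ^+ n <= 1 by rewrite exprn_ile1.
have yn0 n : 0 <= y ^+ n by rewrite exprn_ge0.
have hp n : 0 <= half_poly n y <= 1 by apply: half_poly_itv; rewrite y0.
have E n : (n * 2 ^ n)%:R * y ^+ n = n%:R * (2 * y) ^+ n.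
  by rewrite natrM natrX exprMn mulrA.
have [y2|y2] := ltP y 2^-1.
- have y21 : 0 <= 2 * y < 1 by rewrite mulr_ge0//= mulrC -ltr_pdivlMr// mul1r.
  apply: (@squeeze_cvgr _ _ _ _ (fun n => 1 - n%:R * (2 * y) ^+ n) (fun=> 1)).
  + near=> n; rewrite (andP (hp n)).2 andbT.
    have := @bernoulli_ge (- y ^+ n) (n * 2 ^ n); rewrite lerN2 => /(_ (yn1 n)).
    by rewrite mulrN E.
  + rewrite -[X in _ --> X]subr0.
    by apply: cvgB; [exact: cvg_cst|exact: cvg_natmul_expr].
  + exact: cvg_cst.
- apply: (@squeeze_cvgr _ _ _ _ (fun=> 0) (fun n => n.+1%:R^-1)).
  + near=> n; rewrite (andP (hp n)).1/= -div1r ler_pdivlMr//.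
    apply: (@le_trans _ _ ((1 - y ^+ n) ^+ (n * 2 ^ n) * (1 + y ^+ n) ^+ (n * 2 ^ n))).
      rewrite ler_wpM2l ?(andP (hp n)).1//.
      apply: (le_trans _ (bernoulli_ge (n * 2 ^ n) _)); last first.
        by rewrite (le_trans _ (yn0 n)).
      rewrite E -nat1r lerD2l ler_peMr// exprn_ege1// mulrC.
      by rewrite -ler_pdivrMr// div1r.
    rewrite -exprMn -subr_sqr expr1n exprn_ile1//.
      by rewrite subr_ge0 exprn_ile1.
    by rewrite lerBlDr lerDl sqr_ge0.
  + exact: cvg_cst.
  + exact: cvg_harmonic.
Unshelve. all: by end_near. Qed.

End half_indicator.

Section monotone_class_theorem.
Context {R : realType} {T : pointedType}.
Implicit Types (E M H : set (T -> R)) (f g : T -> R).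

Record bounded_algebra H : Prop := BoundedAlgebra {
  bounded_algebra_bounded : forall f, H f -> bounded_fun f ;
  bounded_algebra_cst : forall c, H (fun=> c) ;
  bounded_algebraD : forall f g, H f -> H g -> H (fun x => f x + g x) ;
  bounded_algebraM : forall f g, H f -> H g -> H (fun x => f x * g x) ;
  bounded_algebra_lim : bounded_limit_closed H }.

Lemma bounded_algebraX H f n : bounded_algebra H -> H f -> H (fun x => f x ^+ n).
Proof.
move=> HH Hf; elim: n => [|n IHn].
  by under eq_fun do rewrite expr0; exact: bounded_algebra_cst.
by under eq_fun do rewrite exprS; exact: bounded_algebraM.
Qed.

Lemma bounded_algebra_lt H f a : bounded_algebra H -> H f ->
  H (fun x => (f x < a)%R%:R).
Proof.
move=> HH Hf; have [B fB] := bounded_algebra_bounded HH Hf.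
have B0 : 0 <= B by exact: le_trans (normr_ge0 _) (fB point).
(* The affine map [y] below sends the range of [f] into [[0, 1]] and the level [a] to [1/2]; the
   summand 1 keeps [D] positive. *)
pose D := B + `|a| + 1.
have D0 : 0 < D by rewrite ltr_wpDl// addr_ge0.
pose y x := (2 * D)^-1 * f x + (2^-1 - (2 * D)^-1 * a).
have Hy : H y.
  apply: bounded_algebraD => //; last exact: bounded_algebra_cst.
  by apply: bounded_algebraM => //; exact: bounded_algebra_cst.
have yE x : y x = 2^-1 + (2 * D)^-1 * (f x - a) by rewrite /y; ring.
have D20 : 0 < (2 * D)^-1 by rewrite invr_gt0 mulr_gt0.
have y01 x : 0 <= y x <= 1.
  have fa : `|f x - a| <= D.
    rewrite (le_trans (ler_normB _ _))// /D -addrA lerD//.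
    by rewrite lerDl.
  have : `|(2 * D)^-1 * (f x - a)| <= 2^-1.
    rewrite normrM gtr0_norm// ler_pdivrMl ?mulr_gt0//.
    by rewrite mulrAC divff// mul1r.
  by rewrite yE ler_norml => /andP[? ?]; apply/andP; split; lra.
apply: (bounded_algebra_lim HH (f_ := fun n x => half_poly n (y x)) (B := 1)).
- move=> n; apply: bounded_algebraX => //.
  under eq_fun do rewrite -mulN1r.
  apply: bounded_algebraD => //; first exact: bounded_algebra_cst.
  by apply: bounded_algebraM => //; [exact: bounded_algebra_cst|exact: bounded_algebraX].
- move=> n x; have /andP[h0 h1] := half_poly_itv n (y01 x).
  by rewrite ger0_norm.
- move=> x; rewrite (_ : (f x < a) = (y x < 2^-1)); last first.
    by rewrite yE -ltrBrDl subrr pmulr_rlt0// subr_lt0.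
  exact: half_poly_cvg.
Qed.

Lemma bounded_algebra_indic_sigma H (G : set (set T)) : bounded_algebra H ->
  (forall A, G A -> H (\1_A)) -> forall A, <<s G >> A -> H (\1_A).
Proof.
move=> HH HG; have HN f : H f -> H (fun x => - f x).
  move=> Hf; under eq_fun do rewrite -mulN1r.
  by apply: bounded_algebraM => //; exact: bounded_algebra_cst.
have HC A : H (\1_A) -> H (\1_(~` A)).
  move=> HA; rewrite (_ : \1_(~` A) = fun x => 1 + - \1_A x); last first.
    by apply/funext => x; rewrite !indicE in_setC; case: (_ \in _); rewrite ?subr0 ?subrr.
  by apply: bounded_algebraD => //; [exact: bounded_algebra_cst|exact: HN].
have H0 : H (\1_set0 : T -> R).
  by rewrite indic0; exact: (bounded_algebra_cst HH 0).
have HI A B : H (\1_A) -> H (\1_B) -> H (\1_(A `&` B)).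
  by move=> HA HB; rewrite indicI; exact: bounded_algebraM.
apply: smallest_sub => //; split => //.
  by move=> A HA; rewrite setTD; exact: HC.
move=> F HF; pose F' n := \bigcup_(i in `I_n) F i.
have HF' n : H (\1_(F' n)).
  rewrite /F' bigcup_mkord; elim: n => [|n IHn]; first by rewrite big_ord0.
  rewrite big_ord_recr/= -[X in \1_X]setCK setCU.
  by apply: (HC); apply: HI; apply: (HC).
apply: (bounded_algebra_lim HH (f_ := fun n => \1_(F' n)) (B := 1)) => //.
  by move=> n x; rewrite indicE; case: (_ \in _); rewrite ?normr0// normr1.
move=> x; have [[i _ Fi]|nF] := pselect ((\bigcup_i F i) x).
  apply: cvg_near_cst; near=> n.
  rewrite !indicE !mem_set//; first by exists i.
  by exists i => //=; near: n; exact: nbhs_infty_gt.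
apply: cvg_near_cst; near=> n; rewrite !indicE !memNset//.
by move=> [i _ Fi]; apply: nF; exists i.
Unshelve. all: by end_near. Qed.

(* The functions [h] such that [h * g] stays in [E] for all [g] with [g * M]
   included in [E] form a bounded algebra: this is the trick that makes [E]
   behave as if it were closed under products. *)
Theorem monotone_class E M :
  (forall f g, E f -> E g -> E (fun x => f x + g x)) ->
  (forall c f, E f -> E (fun x => c * f x)) ->
  bounded_limit_closed E ->
  M `<=` E -> M (fun=> 1) ->
  (forall f g, M f -> M g -> M (fun x => f x * g x)) ->
  (forall f, M f -> bounded_fun f) ->
  forall A, <<s [set B | exists2 f, M f & exists a, B = [set x | f x < a]] >> A ->
    E (\1_A).
Proof.
move=> ED EZ Elim ME M1 MM Mb.
pose E1 := [set g | bounded_fun g /\ forall m, M m -> E (fun x => g x * m x)].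
pose H := [set h | bounded_fun h /\ forall g, E1 g -> E1 (fun x => h x * g x)].
have E1D f g : E1 f -> E1 g -> E1 (fun x => f x + g x).
  move=> [bf Ef] [bg Eg]; split; first exact: bounded_funD.
  move=> m Mm; under eq_fun do rewrite mulrDl.
  by apply: ED; [exact: Ef|exact: Eg].
have E1Z c f : E1 f -> E1 (fun x => c * f x).
  move=> [bf Ef]; split; first by apply: bounded_funM => //; exact: bounded_fun_cst.
  by move=> m Mm; under eq_fun do rewrite -mulrA; apply: EZ; exact: Ef.
have E1lim : bounded_limit_closed E1.
  move=> f_ f B E1f fB cf; split.
    by exists B; exact: bounded_fun_limit fB cf.
  move=> m Mm; have [D mD] := Mb _ Mm.
  apply: (Elim (fun n x => f_ n x * m x) _ (B * D)).
  - by move=> n; have [_] := E1f n; apply.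
  - by move=> n x; rewrite normrM ler_pM.
  - by move=> x; apply: cvgMr_tmp; exact: cf.
have MH : M `<=` H.
  move=> m Mm; split; first exact: Mb.
  move=> g [bg Eg]; split; first by apply: bounded_funM => //; exact: Mb.
  move=> m' Mm'; under eq_fun do rewrite mulrAC mulrC.
  exact/Eg/MM.
have HH : bounded_algebra H.
  split.
  - by move=> f [].
  - by move=> c; split; [exact: bounded_fun_cst|move=> g; exact: E1Z].
  - move=> f g [bf Hf] [bg Hg]; split; first exact: bounded_funD.
    move=> h E1h; under eq_fun do rewrite mulrDl.
    by apply: E1D; [exact: Hf|exact: Hg].
  - move=> f g [bf Hf] [bg Hg]; split; first exact: bounded_funM.
    by move=> h E1h; under eq_fun do rewrite -mulrA; exact/Hf/Hg.
  - move=> f_ f B Hf fB cf; split; first by exists B; exact: bounded_fun_limit fB cf.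
    move=> g E1g; have [[D gD] _] := E1g.
    apply: (E1lim (fun n x => f_ n x * g x) _ (B * D)).
    + by move=> n; have [_] := Hf n; apply.
    + by move=> n x; rewrite normrM ler_pM.
    + by move=> x; apply: cvgMr_tmp; exact: cf.
have E11 : E1 (fun=> 1).
  split; first exact: bounded_fun_cst.
  by move=> m Mm; under eq_fun do rewrite mul1r; exact: ME.
(* Unfolding [H] at the constant 1 of [E1], then [E1] at the constant 1 of [M], brings the indicator
   back into [E]. *)
move=> A GA; have [_ /(_ _ E11)[_ /(_ _ M1)]] : H (\1_A).
  apply: bounded_algebra_indic_sigma GA => // B [f Mf [a ->]].
  rewrite (_ : \1__ = fun x => (f x < a)%R%:R).
    by apply: bounded_algebra_lt => //; exact: MH.
  by apply/funext => x; rewrite indicE; congr ((nat_of_bool _)%:R); apply/idP/idP; rewrite inE.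
by under eq_fun do rewrite !mulr1.
Qed.

End monotone_class_theorem.

(** * Bounded integration and determining classes *)

Section bounded_integration.
Context {d} {T : measurableType d} {R : realType}.
Implicit Types (f g : T -> R) (P : probability T R).

Definition bounded_measurable f := measurable_fun setT f /\ bounded_fun f.

Lemma bounded_measurable_cst c : bounded_measurable (fun=> c).
Proof. by split; [exact: measurable_cst|exact: bounded_fun_cst]. Qed.

Lemma bounded_measurableD f g : bounded_measurable f -> bounded_measurable g ->
  bounded_measurable (fun x => f x + g x).
Proof.
by move=> [mf bf] [mg bg]; split; [exact: measurable_funD|exact: bounded_funD].
Qed.

Lemma bounded_measurableM f g : bounded_measurable f -> bounded_measurable g ->
  bounded_measurable (fun x => f x * g x).
Proof.
by move=> [mf bf] [mg bg]; split; [exact: measurable_funM|exact: bounded_funM].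
Qed.

Lemma bounded_measurableZ c f : bounded_measurable f ->
  bounded_measurable (fun x => c * f x).
Proof. by move=> bf; apply: bounded_measurableM => //; exact: bounded_measurable_cst. Qed.

Lemma bounded_measurableN f : bounded_measurable f ->
  bounded_measurable (fun x => - f x).
Proof.
by move=> /(@bounded_measurableZ (-1)); under eq_fun do rewrite mulN1r.
Qed.

Lemma bounded_measurable_limit (f_ : nat -> T -> R) f B :
  (forall n, measurable_fun setT (f_ n)) -> (forall n x, `|f_ n x| <= B) ->
  (forall x, f_ n x @[n --> \oo] --> f x) -> bounded_measurable f.
Proof.
move=> mf fB fc; split; last by exists B; exact: bounded_fun_limit fB fc.
by apply: (measurable_fun_cvg mf) => x _; exact: fc.
Qed.

Lemma bounded_measurable_integrable P f : bounded_measurable f ->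
  P.-integrable setT (EFin \o f).
Proof.
move=> [mf [B fB]]; apply: measurable_bounded_integrable => //.
  by rewrite -ge0_fin_numE//; exact: fin_num_measure.
exists B; split; first exact: num_real.
by move=> x Bx t _; exact: le_trans (fB t) (ltW Bx).
Qed.

Lemma mean_cst P c : \int[P]_w c = c.
Proof. by rewrite Rintegral_cst// [X in fine X](_ : _ = 1%E) ?mulr1//; exact: probability_setT. Qed.

Lemma meanD P f g : bounded_measurable f -> bounded_measurable g ->
  \int[P]_w (f w + g w) = \int[P]_w f w + \int[P]_w g w.
Proof. by move=> bf bg; rewrite RintegralD//; exact: bounded_measurable_integrable. Qed.

Lemma meanZ P c f : bounded_measurable f ->
  \int[P]_w (c * f w) = c * \int[P]_w f w.
Proof. by move=> bf; rewrite RintegralZl//; exact: bounded_measurable_integrable. Qed.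

Lemma meanN P f : bounded_measurable f ->
  \int[P]_w (- f w) = - \int[P]_w f w.
Proof.
move=> bf; rewrite -[RHS]mulN1r -meanZ//.
by apply: eq_Rintegral => x _; rewrite mulN1r.
Qed.

Lemma le_mean P f g : bounded_measurable f -> bounded_measurable g ->
  (forall w, f w <= g w) -> \int[P]_w f w <= \int[P]_w g w.
Proof.
by move=> bf bg fg; apply: le_Rintegral => //; exact: bounded_measurable_integrable.
Qed.

Lemma mean_bounded P f B : measurable_fun setT f -> (forall x, `|f x| <= B) ->
  `|\int[P]_w f w| <= B.
Proof.
move=> mf fB; have bf : bounded_measurable f by split => //; exists B.
rewrite ler_norml; apply/andP; split.
- have := @le_mean P (fun=> - B) f; rewrite mean_cst; apply => //.
    exact: bounded_measurable_cst.
  by move=> x; have := fB x; rewrite ler_norml => /andP[].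
- have := @le_mean P f (fun=> B); rewrite mean_cst; apply => //.
    exact: bounded_measurable_cst.
  by move=> x; have := fB x; rewrite ler_norml => /andP[].
Qed.

Lemma mean_cvg P (f_ : nat -> T -> R) f B :
  (forall n, measurable_fun setT (f_ n)) -> (forall n x, `|f_ n x| <= B) ->
  (forall x, f_ n x @[n --> \oo] --> f x) ->
  \int[P]_w f_ n w @[n --> \oo] --> \int[P]_w f w.
Proof.
move=> mf fB fc.
have bf := bounded_measurable_limit mf fB fc.
have bf_ n : bounded_measurable (f_ n) by split => //; exists B.
have intf g : bounded_measurable g -> (\int[P]_w (g w)%:E)%E \is a fin_num.
  move=> bg; apply: integrable_fin_num => //.
  exact: bounded_measurable_integrable.
suff : (\int[P]_w (f_ n w)%:E)%E @[n --> \oo] --> (\int[P]_w f w)%:E.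
  by move=> /fine_cvgP[_].
rewrite /Rintegral fineK; last exact: intf.
apply: (@dominated_cvg _ _ _ _ setT measurableT
  (fun n w => (f_ n w)%:E) (fun w => (f w)%:E) (fun=> B%:E)).
- by move=> n; apply/measurable_EFinP; exact: mf.
- by move=> x _; apply/fine_cvgP; split; [near=> n|exact: fc].
- by [].
- apply: (@bounded_measurable_integrable P (fun=> B)).
  exact: bounded_measurable_cst.
- by move=> n x _; rewrite abse_EFin lee_fin.
Unshelve. all: by end_near. Qed.

Lemma eq_probability_mean P (Q : probability T R) f :
  (forall A, measurable A -> P A = Q A) -> \int[P]_w f w = \int[Q]_w f w.
Proof.
by move=> PQ; congr fine; apply: eq_measure_integral => A mA _; exact: PQ.
Qed.

Lemma mean_indic P A : measurable A -> \int[P]_w \1_A w = fine (P A).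
Proof. by move=> mA; rewrite /Rintegral integral_indic// setIT. Qed.

End bounded_integration.

Section determining_class.
Context {d} {T : measurableType d} {R : realType}.
Variable M : set (T -> R).
Hypothesis M_measurable : M `<=` bounded_measurable.
Hypothesis M_mul : forall f g, M f -> M g -> M (fun x => f x * g x).
Hypothesis M_gen : measurable `<=`
  <<s [set B : set T | exists2 f, M f & exists a, B = [set x | f x < a]] >>.

(** The monotone class theorem asks for the constant 1, which a separating family may lack.
    Adjoining it keeps the class multiplicative, and all probabilities agree on it. *)
Let M1 := M `|` [set (fun=> 1)].

Let M1_bounded_measurable f : M1 f -> bounded_measurable f.
Proof. by case=> [/M_measurable//|->]; exact: bounded_measurable_cst. Qed.

Let M1_mul f g : M1 f -> M1 g -> M1 (fun x => f x * g x).
Proof.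
move=> [Mf|->] [Mg|->].
- by left; exact: M_mul.
- by under eq_fun do rewrite mulr1; left.
- by under eq_fun do rewrite mul1r; left.
- by under eq_fun do rewrite mul1r; right.
Qed.

Let M1_gen : measurable `<=`
  <<s [set B : set T | exists2 f, M1 f & exists a, B = [set x | f x < a]] >>.
Proof.
apply: (subset_trans M_gen); apply: sub_sigma_algebra2 => //.
by move=> _ [f Mf [a ->]]; exists f => //; [left|exists a].
Qed.

Lemma determining_class_eq (P Q : probability T R) :
  (forall f, M f -> \int[P]_w f w = \int[Q]_w f w) ->
  forall A, measurable A -> P A = Q A.
Proof.
move=> PQ A mA.
pose E := [set f | bounded_measurable f /\ \int[P]_w f w = \int[Q]_w f w].
suff : E (\1_A).
  move=> [_]; rewrite !mean_indic// => h.
  by rewrite -(fineK (fin_num_measure P _ mA)) h fineK//; exact: fin_num_measure.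
apply: (@monotone_class R T E M1) (M1_gen mA) => //.
- move=> f g [bf Ef] [bg Eg]; split; first exact: bounded_measurableD.
  by rewrite !meanD// Ef Eg.
- move=> c f [bf Ef]; split; first exact: bounded_measurableZ.
  by rewrite !meanZ// Ef.
- move=> f_ f B Ef fB cf.
  have mf n : measurable_fun setT (f_ n) by have [[]] := Ef n.
  split; first exact: bounded_measurable_limit mf fB cf.
  have cP := mean_cvg (P := P) mf fB cf; have cQ := mean_cvg (P := Q) mf fB cf.
  apply: (cvg_unique _ cP); first exact: norm_hausdorff.
  rewrite (_ : (fun n => \int[P]_w f_ n w) = (fun n => \int[Q]_w f_ n w))//.
  by apply/funext => n; have [] := Ef n.
- move=> f Mf; split; first exact: M1_bounded_measurable.
  by case: Mf => [/PQ//|->]; rewrite !mean_cst.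
- by right.
- by move=> f /M1_bounded_measurable[].
Qed.

Lemma determining_class_measurable d' (Y : measurableType d')
    (p : Y -> probability T R) :
  (forall f, M f -> measurable_fun setT (fun y => \int[p y]_w f w)) ->
  forall A, measurable A -> measurable_fun setT (fun y => p y A).
Proof.
move=> mp A mA.
pose E := [set f | bounded_measurable f /\
  measurable_fun setT (fun y => \int[p y]_w f w)].
suff : E (\1_A).
  move=> [_ mA1]; rewrite (_ : (fun y => p y A) =
    (fun y => (\int[p y]_w \1_A w)%:E)); first exact/measurable_EFinP.
  apply/funext => y; rewrite mean_indic// fineK//; exact: fin_num_measure.
apply: (@monotone_class R T E M1) (M1_gen mA) => //.
- move=> f g [bf Ef] [bg Eg]; split; first exact: bounded_measurableD.
  under eq_fun do rewrite meanD//.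
  exact: measurable_funD.
- move=> c f [bf Ef]; split; first exact: bounded_measurableZ.
  under eq_fun do rewrite meanZ//.
  by apply: measurable_funM => //; exact: measurable_cst.
- move=> f_ f B Ef fB cf.
  have mf n : measurable_fun setT (f_ n) by have [[]] := Ef n.
  split; first exact: bounded_measurable_limit mf fB cf.
  apply: (@measurable_fun_cvg _ _ _ _
    (fun n y => \int[p y]_w f_ n w)).
    by move=> n; have [] := Ef n.
  by move=> y _; exact: mean_cvg mf fB cf.
- move=> f Mf; split; first exact: M1_bounded_measurable.
  case: Mf => [/mp//|->]; under eq_fun do rewrite mean_cst.
  exact: measurable_cst.
- by right.
- by move=> f /M1_bounded_measurable[].
Qed.

End determining_class.

(** * Mixtures of measurable kernels *)

Section mixture.
Context {d1 d2} {Y : measurableType d1} {T : measurableType d2} {R : realType}.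
Variables (mu : probability Y R) (p : Y -> probability T R).
Hypothesis mp : forall A, measurable A -> measurable_fun setT (fun y => p y A).

Let q (y : Y) : giry T R := p y.

Let mq : measurable_fun setT q.
Proof. by apply: measurable_giry_codensity => // B mB; exact: mp. Qed.

Let mix : set T -> \bar R := giry_bind (mu : giry Y R) mq.

Let mix0 : mix set0 = 0%E. Proof. exact: measure0. Qed.
Let mix_ge0 A : (0 <= mix A)%E. Proof. exact: measure_ge0. Qed.
Let mix_sigma_additive : semi_sigma_additive mix.
Proof. exact: measure_semi_sigma_additive. Qed.

HB.instance Definition _ := isMeasure.Build _ _ _ mix
  mix0 mix_ge0 mix_sigma_additive.

Let mixE A : measurable A -> mix A = (\int[mu]_y p y A)%E.
Proof.
move=> mA; rewrite -[in LHS](setIT A) -[LHS]integral_indic//.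
rewrite [LHS]giry_int_bind//; last exact/measurable_EFinP/measurable_indic.
by apply: eq_integral => y _; rewrite /giry_int integral_indic// setIT.
Qed.

Let mixT : mix [set: T] = 1%E.
Proof.
rewrite mixE//; under eq_integral do rewrite probability_setT.
by rewrite integral_cst// mul1e; exact: probability_setT.
Qed.

HB.instance Definition _ := Measure_isProbability.Build _ _ _ mix mixT.

Let mean_measurable_ge0 f : bounded_measurable f -> (forall x, 0 <= f x) ->
  measurable_fun setT (fun y => \int[p y]_w f w).
Proof.
move=> [mf bf] f0.
have mh : measurable_fun setT (giry_int ^~ (EFin \o f) : giry T R -> \bar R).
  by apply: measurable_giry_int; [exact/measurable_EFinP|move=> x; rewrite lee_fin].
by apply: measurableT_comp (measurableT_comp mh mq) => //.
Qed.

Let mix_mean_ge0 f : bounded_measurable f -> (forall x, 0 <= f x) ->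
  \int[mix]_w f w = \int[mu]_y \int[p y]_w f w.
Proof.
move=> bf f0; rewrite {1}/Rintegral; congr fine.
rewrite [LHS]giry_int_bind//; last first.
  by apply/measurable_EFinP; case: bf.
apply: eq_integral => y _; rewrite /giry_int /Rintegral fineK//.
by apply: integrable_fin_num => //; exact: bounded_measurable_integrable.
Qed.

(** The integral formula for the bind is stated for nonnegative functions. A bounded function
    becomes one after adding a constant, whose mean is the same under every probability. *)
Let shift_ge0 (f : T -> R) : bounded_measurable f -> exists2 B, forall x, 0 <= f x + B &
  bounded_measurable (fun x => f x + B).
Proof.
move=> bf; have [_ [B fB]] := bf; exists B.
  by move=> x; have := fB x; rewrite ler_norml -subr_ge0 opprK => /andP[].
by apply: bounded_measurableD => //; exact: bounded_measurable_cst.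
Qed.

Lemma kernel_mean_measurable (f : T -> R) : bounded_measurable f ->
  bounded_measurable (fun y => \int[p y]_w f w).
Proof.
move=> bf; have [mf [D fD]] := bf; split; last first.
  by exists D => y; exact: mean_bounded.
have [B B0 bfB] := shift_ge0 bf.
rewrite (_ : (fun y => _) = (fun y => \int[p y]_w (f w + B) - B)); last first.
  apply/funext => y; rewrite meanD//; last exact: bounded_measurable_cst.
  by rewrite mean_cst addrK.
by apply: measurable_funB; [exact: mean_measurable_ge0|exact: measurable_cst].
Qed.

Lemma mixture_exists : exists Q : probability T R,
  (forall A, measurable A -> Q A = (\int[mu]_y p y A)%E) /\
  (forall f, bounded_measurable f ->
    \int[Q]_w f w = \int[mu]_y \int[p y]_w f w).
Proof.
exists mix; split; first exact: mixE.
move=> f bf; have [B B0 bfB] := shift_ge0 bf.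
have cB := @bounded_measurable_cst.
apply: (@addIr _ B); rewrite -[X in _ + X = _](mean_cst (mix : probability T R)).
rewrite -meanD// mix_mean_ge0//.
under eq_Rintegral do rewrite meanD// mean_cst.
by rewrite meanD// ?mean_cst//; exact: kernel_mean_measurable.
Qed.

End mixture.

(** * Lexicographic maximization over compact sets *)

Section argmax.
Context {R : realType} {Y : topologicalType}.
Implicit Types (l : Y -> R) (A K F : set Y).

Definition argmax l A := [set y | A y /\ forall z, A z -> l z <= l y].

Fixpoint lexmax (l : nat -> Y -> R) A n :=
  if n is n'.+1 then argmax (l n') (lexmax l A n') else A.

Definition lexmax_inf (l : nat -> Y -> R) A := \bigcap_n lexmax l A n.

(** Closedness relative to [A]: in an arbitrary topological space [Y] a compact set need not be
    closed, but a relatively closed part of a compact set is still compact. *)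
Definition closed_in A K := exists2 B, closed B & K = A `&` B.

Lemma closed_in_compact A K : compact A -> closed_in A K -> compact K.
Proof. by move=> cA [B cB ->]; exact: compact_closedI. Qed.

Lemma closed_in_subset A K : closed_in A K -> K `<=` A.
Proof. by move=> [B _ ->] y []. Qed.

Lemma closed_inI A K F : closed_in A K -> closed F -> closed_in A (K `&` F).
Proof.
move=> [B cB ->] cF; exists (B `&` F); last by rewrite setIA.
exact: closedI.
Qed.

Lemma closed_in_bigcap A (K : nat -> set Y) : (forall n, closed_in A (K n)) ->
  closed_in A (\bigcap_n K n).
Proof.
move=> cK; have /choice[B BP] n : exists B, closed B /\ K n = A `&` B.
  by have [B ? ?] := cK n; exists B.
exists (\bigcap_n B n); first by apply: closed_bigI => n _; have [] := BP n.
apply/seteqP; split=> y.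
  move=> Ky; split; first by have := Ky 0%N I; rewrite (BP 0%N).2 => -[].
  by move=> n _; have := Ky n I; rewrite (BP n).2 => -[].
by move=> [Ay By] n _; rewrite (BP n).2; split => //; exact: By.
Qed.

Lemma decreasing_sets (K : nat -> set Y) : (forall n, K n.+1 `<=` K n) ->
  forall n m, (n <= m)%N -> K m `<=` K n.
Proof.
move=> Kd n m /subnK <-; elim: (m - n)%N => [|k IHk] //.
by rewrite addSn; exact: subset_trans (Kd _) IHk.
Qed.

(** The [K n] generate a filter on the compact set [A], and relative closedness puts a cluster point
    of it in each of them. *)
Lemma compact_nested A (K : nat -> set Y) : compact A ->
  (forall n, closed_in A (K n)) -> (forall n, K n.+1 `<=` K n) ->
  (forall n, K n !=set0) -> \bigcap_n K n !=set0.
Proof.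
move=> cA cK Kd K0.
have Kmono := decreasing_sets Kd.
pose G := filter_from setT K.
have FG : ProperFilter G.
  apply: filter_from_proper; last by move=> n _; exact: K0.
  apply: filter_from_filter; first by exists 0%N.
  move=> i j _ _; exists (maxn i j) => // y Ky; split.
    exact: Kmono _ _ (leq_maxl i j) _ Ky.
  exact: Kmono _ _ (leq_maxr i j) _ Ky.
have GA : G A by exists 0%N => //; exact: closed_in_subset.
have [y [Ay yG]] := cA _ FG GA.
exists y => n _; have [B cB KB] := cK n; rewrite KB; split => //.
apply: cB => U yU; rewrite setIC.
have [|z [Kz Uz]] := yG (K n) U _ yU; first by exists n.
by exists z; split => //; move: Kz; rewrite KB => -[].
Qed.

Lemma closed_superlevel l q : continuous l -> closed [set y | q <= l y].
Proof.
move=> cl; apply: (@preimage_closed _ _ l [set r | q <= r]); last exact: closed_ge.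
exact: in1W.
Qed.

Lemma argmax_closed_in A l K : continuous l -> closed_in A K ->
  closed_in A (argmax l K).
Proof.
move=> cl [B cB KB].
exists (B `&` \bigcap_(z in K) [set y | l z <= l y]).
  by apply: closedI => //; apply: closed_bigI => z _; exact: closed_superlevel.
rewrite setIA -KB; apply/seteqP; split => y [Ky yK]; split => //.
Qed.

Lemma compact_max A l : continuous l -> compact A -> A !=set0 ->
  exists2 y, A y & forall z, A z -> l z <= l y.
Proof.
move=> cl cA A0; have [|y /set_mem Ay yA] := compact_EVT_max A0 cA (f := l).
  exact: continuous_subspaceT.
by exists y => // z Az; apply: yA; exact: mem_set.
Qed.

Lemma argmax_nonempty A l : continuous l -> compact A -> A !=set0 ->
  argmax l A !=set0.
Proof. by move=> cl cA A0; have [y Ay yA] := compact_max cl cA A0; exists y. Qed.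

Section lexmax.
Variables (l : nat -> Y -> R) (A : set Y).
Hypotheses (cl : forall n, continuous (l n)) (cA : compact A) (A0 : A !=set0).

Lemma lexmax_closed_in n : closed_in A (lexmax l A n).
Proof.
elim: n => [|n IHn] /=; last exact: argmax_closed_in.
by exists setT => //; rewrite setIT.
Qed.

Lemma lexmax_compact n : compact (lexmax l A n).
Proof. exact: closed_in_compact cA (lexmax_closed_in n). Qed.

Lemma lexmax_nonempty n : lexmax l A n !=set0.
Proof.
elim: n => [|n IHn] //=; apply: argmax_nonempty => //; exact: lexmax_compact.
Qed.

Lemma lexmax_decr n : lexmax l A n.+1 `<=` lexmax l A n.
Proof. by move=> y []. Qed.

Lemma lexmax_inf_nonempty : lexmax_inf l A !=set0.
Proof.
apply: (compact_nested cA); first exact: lexmax_closed_in.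
- exact: lexmax_decr.
- exact: lexmax_nonempty.
Qed.

Lemma lexmax_inf_compact : compact (lexmax_inf l A).
Proof.
by apply: closed_in_compact cA _; apply: closed_in_bigcap => n; exact: lexmax_closed_in.
Qed.

Lemma lexmax_inf_sub : lexmax_inf l A `<=` A.
Proof. by move=> y /(_ 0%N I). Qed.

Lemma lexmax_inf_eq y z n : lexmax_inf l A y -> lexmax_inf l A z -> l n y = l n z.
Proof.
move=> /(_ n.+1 I)[yn ly] /(_ n.+1 I)[zn lz].
by apply/eqP; rewrite eq_le ly// lz.
Qed.

End lexmax.

End argmax.

Lemma countable_bigcapT_measurable d (T : measurableType d) (U : countType)
    (F : U -> set T) : (forall i, measurable (F i)) -> measurable (\bigcap_i F i).
Proof.
move=> mF; rewrite -[X in measurable X]setCK setC_bigcap; apply: measurableC.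
apply: countable_bigcupT_measurable => [|i]; first exact: countableP.
exact: measurableC.
Qed.

(** * Measurability of set-valued maps of maximizers *)

Section hit_measurable.
Context {R : realType} {d} {X : measurableType d} {Y : topologicalType}.
Implicit Types (C : X -> set Y) (l : Y -> R).

Definition hit_measurable C :=
  forall F, closed F -> measurable [set x | C x `&` F !=set0].

(** The maximizers meet [F] exactly when [l] has the same maximum on [C x] and on its intersection
    with [F]. This is tested by countably many levels: every rational level reached on the former
    must be reached on the latter. *)
Lemma hit_measurable_argmax C l : continuous l ->
  (forall x, compact (C x)) -> (forall x, C x !=set0) ->
  hit_measurable C -> hit_measurable (fun x => argmax l (C x)).
Proof.
move=> cl cC C0 mC F cF.
have cge (q : rat) : closed [set y | ratr q <= l y] by exact: closed_superlevel.
rewrite (_ : [set x | _] = \bigcap_(q : rat)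
    (~` [set x | C x `&` [set y | ratr q <= l y] !=set0] `|`
     [set x | C x `&` (F `&` [set y | ratr q <= l y]) !=set0])).
  apply: countable_bigcapT_measurable => q.
  apply: measurableU; first by apply: measurableC; exact: mC.
  by apply: mC; exact: closedI.
apply/seteqP; split=> x.
  move=> [y [[Cy ymax] Fy]] q _ /=.
  have [[z [Cz qz]]|] := pselect (C x `&` [set y | ratr q <= l y] !=set0).
    by right; exists y; do !split => //=; exact: le_trans qz (ymax _ Cz).
  by left.
move=> h.
have [m Cm mmax] := compact_max cl (cC x) (C0 x).
(* A rational level below the maximum is reached on [C x], hence on its intersection with [F], which
   is therefore non-empty. *)
have CF0 : C x `&` F !=set0.
  have [q qm] : exists q : rat, ratr q < l m.
    have [|q] := @rat_in_itvoo R (l m - 1) (l m); first by rewrite ltrBlDr ltrDl.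
    by rewrite in_itv/= => /andP[_ ?]; exists q.
  have [[]|[y [Cy [Fy _]]]] := h q I; last by exists y.
  by exists m; split => //; exact: ltW.
have [y [Cy Fy] ymax] := compact_max cl (compact_closedI (cC x) cF) CF0.
exists y; split => //; split => // z Cz.
apply: le_trans (mmax _ Cz) _; rewrite leNgt; apply/negP => ym.
have [q] := rat_in_itvoo ym; rewrite in_itv/= => /andP[yq qm].
have [[]|[z' [Cz' [Fz' /= qz']]]] := h q I.
  by exists m; split => //; exact: ltW.
by have := ymax z' (conj Cz' Fz'); rewrite leNgt (lt_le_trans yq).
Qed.

(** By compactness the intersection meets [F] as soon as each [K n x] does, so a countable
    intersection of measurable sets describes the event. *)
Lemma hit_measurable_bigcap C (K : nat -> X -> set Y) :
  (forall x, compact (C x)) -> (forall n x, closed_in (C x) (K n x)) ->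
  (forall n x, K n.+1 x `<=` K n x) -> (forall n, hit_measurable (K n)) ->
  hit_measurable (fun x => \bigcap_n K n x).
Proof.
move=> cC cK Kd mK F cF.
rewrite (_ : [set x | _] = \bigcap_n [set x | K n x `&` F !=set0]).
  by apply: bigcapT_measurable => n; exact: mK.
apply/seteqP; split=> x.
  by move=> [y [Ky Fy]] n _; exists y; split => //; exact: Ky.
move=> h.
have [||n|y yK] := compact_nested (cC x) (K := fun n => K n x `&` F).
- by move=> n; exact: closed_inI.
- by move=> n y [/Kd].
- exact: h.
- by exists y; split; [move=> n _; have [] := yK n I|have [] := yK 0%N I].
Qed.

Section lexmax.
Variables (C : X -> set Y) (l : nat -> Y -> R).
Hypotheses (cl : forall n, continuous (l n)) (cC : forall x, compact (C x)).
Hypotheses (C0 : forall x, C x !=set0) (mC : hit_measurable C).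

Lemma hit_measurable_lexmax n : hit_measurable (fun x => lexmax l (C x) n).
Proof.
elim: n => [|n IHn] //=; apply: hit_measurable_argmax => // x.
  exact: lexmax_compact.
exact: lexmax_nonempty.
Qed.

Lemma hit_measurable_lexmax_inf : hit_measurable (fun x => lexmax_inf l (C x)).
Proof.
apply: (hit_measurable_bigcap cC) => [n x|n x|n].
- exact: lexmax_closed_in.
- exact: lexmax_decr.
- exact: hit_measurable_lexmax.
Qed.

End lexmax.

End hit_measurable.

(** * Borel sets of the path space *)

Section path_evaluation.
Context {R : realType} {X : ptopologicalType}.
Local Notation Omega := (path_space R X).

Lemma to_time_continuous : continuous (@to_time R).
Proof.
apply: (@continuous_comp_initial _ _ _ (set_val : `[0, +oo[%classic -> R) (@to_time R)).
rewrite (_ : _ \o _ = (cst 0 \max id)); last by apply/funext.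
move=> x; apply: (@continuous_max R R (cst 0 : R -> R^o) id x); first exact: cvg_cst.
exact: cvg_id.
Qed.

Lemma to_time_val (t : time R) : to_time (\val t) = t.
Proof.
case: t => t t0; apply: eq_exist => /=; apply: max_r.
by move: t0; rewrite inE /= in_itv /= andbT.
Qed.

Lemma time_ge0 (t : time R) : 0 <= \val t.
Proof. by case: t => t /=; rewrite inE /= in_itv /= andbT. Qed.

Lemma time_val_continuous : continuous (fun t : time R => \val t).
Proof. exact: (@initial_continuous _ _ (set_val : `[0, +oo[%classic -> R)). Qed.

Lemma path_continuous (w : Omega) : continuous (w : time R -> X).
Proof. exact: (@cts_fun _ _ (w : continuousType (time R) X)). Qed.

Lemma path_to_time_continuous (w : Omega) : continuous (fun r : R => w (to_time r)).
Proof.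
move=> r; apply: (@continuous_comp _ _ _ (@to_time R) w).
  exact: to_time_continuous.
exact: path_continuous.
Qed.

Lemma evaluation_continuous (t : time R) : continuous (fun w : Omega => w t).
Proof.
apply/continuousP => O oO.
have oW := compact_open_open (@compact_set1 _ t) oO.
exists [set g | g @` [set t] `<=` O]; first exact: oW.
apply/seteqP; split=> w /=; first by move=> wO; apply: wO; exists t.
by move=> wO _ [_ -> <-].
Qed.

End path_evaluation.

Section borel.
Context {R : realType} {T : ptopologicalType}.

Lemma continuous_borel_measurable (f : T -> R) : continuous f ->
  measurable_fun [set: borel T] (f : borel T -> R).
Proof.
move=> cf; apply: (measurability (@RGenOpens.G R)) => [|_ [_ [a [b ->]] <-]].
  exact: RGenOpens.measurableE.
rewrite setTI; apply: sub_gen_smallest.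
by move/continuousP : cf; apply; exact: interval_open.
Qed.

Lemma continuous_borel_measurable_map (U : ptopologicalType) (f : T -> U) :
  continuous f -> measurable_fun [set: borel T] (f : borel T -> borel U).
Proof.
move=> cf; apply: (@measurability _ _ (borel T) (borel U) setT f (@open U)) => //.
move=> _ [B oB <-]; rewrite setTI; apply: sub_gen_smallest.
by move/continuousP : cf; exact.
Qed.

Lemma bounded_funP (f : T -> R) : [bounded f x | x in [set: T]] <-> bounded_fun f.
Proof.
split=> [[M [_ fM]]|[B fB]].
  by exists (M + 1) => x; apply: fM => //; rewrite ltrDl.
exists B; split; first exact: num_real.
by move=> M BM x _; exact: le_trans (fB x) (ltW BM).
Qed.

Lemma CbP (f : T -> R) : Cb f <-> continuous f /\ bounded_fun f.
Proof. by split=> -[cf bf]; split => //; exact/bounded_funP. Qed.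

Lemma Cb_bounded_measurable (f : T -> R) : Cb f ->
  @bounded_measurable _ (borel T) R f.
Proof. by move=> /CbP[cf bf]; split => //; exact: continuous_borel_measurable. Qed.

Lemma CbD (f g : T -> R) : Cb f -> Cb g -> Cb (fun x => f x + g x).
Proof.
move=> /CbP[cf bf] /CbP[cg bg]; apply/CbP; split; last exact: bounded_funD.
by move=> x; apply: cvgD; [exact: cf|exact: cg].
Qed.

Lemma CbM (f g : T -> R) : Cb f -> Cb g -> Cb (fun x => f x * g x).
Proof.
move=> /CbP[cf bf] /CbP[cg bg]; apply/CbP; split; last exact: bounded_funM.
by move=> x; apply: cvgM; [exact: cf|exact: cg].
Qed.

Lemma Cb_cst (c : R) : Cb (fun _ : T => c).
Proof. by apply/CbP; split; [move=> x; exact: cvg_cst|exact: bounded_fun_cst]. Qed.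

Lemma CbZ (c : R) (f : T -> R) : Cb f -> Cb (fun x => c * f x).
Proof. by apply: CbM; exact: Cb_cst. Qed.

Lemma CbN (f : T -> R) : Cb f -> Cb (fun x => - f x).
Proof. by move=> /(CbZ (-1)); under eq_fun do rewrite mulN1r. Qed.

Lemma law_mean_continuous (f : T -> R) : Cb f ->
  continuous (fun P : law R T => law_mean P f).
Proof.
move=> fCb.
pose F (P : law R T) : {ptws @Cb R T -> R} := fun g => law_mean P (\val g).
have cF : continuous F by exact: initial_continuous.
pose f' : @Cb R T := exist _ f (mem_set fCb).
have ce : continuous (fun g : {ptws @Cb R T -> R} => g f').
  by move=> g; exact: (@proj_continuous _ (fun _ => R) f').
by move=> P; exact: (continuous_comp (cF P) (ce _)).
Qed.

End borel.

Section observables.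
Context {R : realType} {X : ptopologicalType} (phi : X -> R).
Hypothesis phi_Cb : Cb phi.
Local Notation Omega := (path_space R X).

Lemma path_observable_continuous (w : Omega) :
  continuous (fun r : R => phi (w (to_time r))).
Proof.
have /CbP[cphi _] := phi_Cb.
move=> r; apply: (@continuous_comp _ _ _ (fun r => w (to_time r)) phi).
  exact: path_to_time_continuous.
exact: cphi.
Qed.

Lemma evaluation_Cb (t : time R) : Cb (fun w : Omega => phi (w t)).
Proof.
have /CbP[cphi [B phiB]] := phi_Cb; apply/CbP; split; last by exists B.
move=> w; apply: (@continuous_comp _ _ _ (fun w : Omega => w t) phi).
  exact: evaluation_continuous.
exact: cphi.
Qed.

End observables.

Section separating_functions.
Context {R : realType} {X : ptopologicalType} (phi : nat -> X -> R).
Hypothesis phi_cont : forall n, continuous (phi n).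
Hypothesis phi_sep : strongly_separates_points (range phi).
Local Notation Omega := (path_space R X).

Lemma separating_nbhs (x : X) (O : set X) : nbhs x O ->
  exists (s : seq nat) (e : R), 0 < e /\
    forall y, (forall n, n \in s -> `|phi n y - phi n x| < e) -> O y.
Proof.
move=> /phi_sep[k [g [gphi infg]]].
have /choice[n ng] l : exists n, phi n = g l.
  by have [n _ <-] := gphi l; exists n.
have [e e0 einf] : exists2 e : R, 0 < e & (e%:E <= ereal_inf
    [set (\big[Num.max/0]_(l < k.+1) `|g l y - g l x|)%:E | y in ~` O])%E.
  move: infg; case: (ereal_inf _) => [r| |] //.
    by rewrite lte_fin => r0; exists r.
  (* The infimum is infinite only over the empty set, when [O] is the whole space; any radius then
     works. *)
  by move=> _; exists 1 => //; exact: leey.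
exists [seq n l | l <- enum 'I_k.+1], e; split => // y yx.
apply: contrapT => nOy.
have : (e%:E <= (\big[Num.max/0]_(l < k.+1) `|g l y - g l x|)%:E)%E.
  by apply: le_trans einf _; apply: ereal_inf_lbound; exists y.
rewrite lee_fin leNgt => /negP; apply.
elim/big_ind : _ => //.
  by move=> a b ae be; rewrite gt_max ae.
by move=> l _; rewrite -ng; apply: yx; apply: map_f; rewrite mem_enum.
Qed.

(** Finite lists of indices with rational centres and radii give only countably many boxes, and
    strong separation makes every open set the union of the boxes that it contains. *)
Lemma borel_generated_by_separating : @measurable _ (borel X) `<=`
  <<s [set B : set X | exists2 f, range phi f & exists a, B = [set x | f x < a]] >>.
Proof.
set G := [set B | _].
pose X' := g_sigma_algebraType G.
have mphi n : measurable_fun [set: X'] (phi n : X' -> R).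
  apply: (measurability (@RGenInftyO.G R)) => [|_ [_ [a ->] <-]].
    exact: RGenInftyO.measurableE.
  rewrite setTI; apply: sub_gen_smallest; exists (phi n); first by exists n.
  by exists a; apply/seteqP; split=> x /=; rewrite in_itv.
pose box (i : seq (nat * rat) * rat) : set X' :=
  [set y | forall j, j \in i.1 -> `|phi j.1 y - ratr j.2| < ratr i.2].
have mbox i : measurable (box i).
  rewrite (_ : box i = \bigcap_j (if j \in i.1 then
      [set y | `|phi j.1 y - ratr j.2| < ratr i.2] else setT)); last first.
    apply/seteqP; split=> y /=; first by move=> yi j _; case: ifP => // /yi.
    by move=> yi j ji; have := yi j I; rewrite ji.
  apply: countable_bigcapT_measurable => j; case: ifP => // _.
  rewrite (_ : [set y | _] = setT `&`
    (fun y : X' => `|phi j.1 y - ratr j.2|) @^-1` `]-oo, ratr i.2[); last first.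
    by rewrite setTI; apply/seteqP; split=> y /=; rewrite in_itv.
  suff : measurable_fun setT (fun y : X' => `|phi j.1 y - ratr j.2|).
    by apply => //; exact: measurable_itv.
  apply: measurableT_comp => //.
  by apply: measurable_funB => //; exact: measurable_cst.
apply: smallest_sub; first exact: (@sigma_algebra_measurable _ X').
move=> O oO.
rewrite (_ : O = \bigcup_(i : seq (nat * rat) * rat)
    if `[< box i `<=` O >] then box i else set0).
  apply: (@countable_bigcupT_measurable _ X') => [|i]; first exact: countableP.
  by case: ifP => // _; exact: measurable0.
apply/seteqP; split=> x; last first.
  by move=> [i _]; case: asboolP => // bO /bO.
move=> Ox.
have [s [e [e0 sO]]] := separating_nbhs (open_nbhs_nbhs (conj oO Ox)).
(* Half of [e], because [x] and [y] are compared through the rational centre of the box. *)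
have [e'] : exists q : rat, ratr q \in `]0, (e / 2)[.
  by apply: rat_in_itvoo; rewrite divr_gt0.
rewrite in_itv/= => /andP[e'0 e'e].
have /choice[q qx] n : exists q : rat, `|phi n x - ratr q| < ratr e'.
  have [|q] := @rat_in_itvoo R (phi n x - ratr e') (phi n x + ratr e').
    by rewrite ltrD2l gt0_cp.
  rewrite in_itv/= => qx; exists q.
  by rewrite ltr_distlC.
exists ([seq (n, q n) | n <- s], e') => //.
have bO : box ([seq (n, q n) | n <- s], e') `<=` O.
  move=> y yb; apply: sO => n ns.
  have := yb (n, q n); rewrite map_f// => /(_ isT)/= yq.
  have xq := qx n; rewrite [e]splitr.
  rewrite (_ : _ - _ = (phi n y - ratr (q n)) - (phi n x - ratr (q n))).
    rewrite (le_lt_trans (ler_normB _ _))// ltrD//.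
      exact: lt_trans yq _.
    exact: lt_trans xq _.
  by rewrite opprB addrA subrK.
rewrite asboolT//= => j /mapP[n ns ->] /=; exact: qx.
Qed.

End separating_functions.

(** * Cylinder functions generate the Borel sets of the path space *)

Section cylinders.
Context {R : realType} {X : ptopologicalType} (phi : nat -> X -> R).
Hypothesis phi_Cb : forall n, Cb (phi n).
Hypothesis phi_sep : strongly_separates_points (range phi).
Local Notation Omega := (path_space R X).

Let phi_cont n : continuous (phi n). Proof. by have /CbP[] := phi_Cb n. Qed.

(** Rational times and integer indices make this a countable family, which a lexicographic
    maximization can run through. Products correspond to concatenation of lists; negative times are
    read as 0 by [to_time]. *)
Definition cylinder (L : seq (rat * nat)) (w : Omega) : R :=
  \prod_(i <- L) phi i.2 (w (to_time (ratr i.1))).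

Lemma cylinder_Cb L : Cb (cylinder L).
Proof.
rewrite /cylinder; elim: L => [|i L IHL].
  by under eq_fun do rewrite big_nil; exact: Cb_cst.
by under eq_fun do rewrite big_cons; apply: CbM => //; exact: evaluation_Cb.
Qed.

(** An open time interval, then the centre, radius and index of a constraint. With the interval open
    and the inequality non-strict, continuity of paths allows the constraint to be tested at
    rational times only. *)
Let tube (i : rat * rat * (rat * rat * nat)) : set Omega :=
  [set w | forall r : R, ratr i.1.1 < r < ratr i.1.2 ->
     `|phi i.2.2 (w (to_time r)) - ratr i.2.1.1| <= ratr i.2.1.2].

Let tubes (I : seq (rat * rat * (rat * rat * nat))) : set Omega :=
  [set w | forall i, i \in I -> tube i w].

Let tubes_filter (w : Omega) : set_system Omega :=
  filter_from [set I | tubes I w] tubes.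

Let tubes_filterP (w : Omega) : Filter (tubes_filter w).
Proof.
apply: filter_from_filter; first by exists [::].
move=> I J Iw Jw; exists (I ++ J) => [i|v vIJ].
  by rewrite mem_cat => /orP[/Iw|/Jw].
by split=> i iI; apply: vIJ; rewrite mem_cat iI// orbT.
Qed.

(** Finitely many [phi n] isolate [w t] inside [O], and continuity of [w] keeps each of them near a
    rational value on an interval around [t] with rational endpoints; these data are tubes through
    [w]. An interval may begin before 0, where [to_time] freezes the path. *)
Let tubes_near (w : Omega) (t : time R) (O : set X) : open O -> O (w t) ->
  \forall t' \near t & v \near tubes_filter w, O ((v : Omega) t').
Proof.
move=> oO Owt.
have [s [e [e0 sO]]] := separating_nbhs phi_sep (open_nbhs_nbhs (conj oO Owt)).
have [e'] : exists q : rat, ratr q \in `]0, (e / 3)[.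
  by apply: rat_in_itvoo; rewrite divr_gt0.
rewrite in_itv/= => /andP[e'0 e'e].
pose t0 := \val t.
have /choice[q qx] n : exists q : rat, `|phi n (w t) - ratr q| < ratr e'.
  have [|q] := @rat_in_itvoo R (phi n (w t) - ratr e') (phi n (w t) + ratr e').
    by rewrite ltrD2l gt0_cp.
  by rewrite in_itv/= => qx; exists q; rewrite ltr_distlC.
have /choice[cd cdP] n : exists cd : rat * rat, ratr cd.1 < t0 < ratr cd.2 /\
    forall r, ratr cd.1 < r < ratr cd.2 ->
      `|phi n (w (to_time r)) - ratr (q n)| <= ratr e'.
  have : \forall r \near t0, `|phi n (w (to_time r)) - ratr (q n)| < ratr e'.
    have h : phi n (w (to_time r)) - ratr (q n) @[r --> t0] --> phi n (w t) - ratr (q n).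
      apply: cvgB; last exact: cvg_cst.
      have := path_observable_continuous (phi_Cb n) (w := w) (x := t0).
      by rewrite /continuous_at /t0 to_time_val.
    by apply: (cvgr_norm_lt _ h); exact: qx.
  move=> /nbhs_ballP[d /= d0 dP].
  have [|c] := @rat_in_itvoo R (t0 - d) t0; first by rewrite ltrBlDr ltrDl.
  rewrite in_itv/= => /andP[c1 c2].
  have [|c'] := @rat_in_itvoo R t0 (t0 + d); first by rewrite ltrDl.
  rewrite in_itv/= => /andP[c1' c2'].
  exists (c, c') => /=; split; first by rewrite c2.
  move=> r /andP[cr rc]; apply/ltW/dP.
  by rewrite /ball/= ltr_distlC (lt_trans c1)//= (lt_trans rc).
pose I := [seq (cd n, (q n, e', n)) | n <- s].
have Iw : tubes I w.
  by move=> _ /mapP[n ns ->] r /=; exact: (cdP n).2.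
exists ([set t' | forall n, n \in s -> ratr (cd n).1 < \val t' < ratr (cd n).2],
    tubes I); last first.
  move=> [t' v] [/= t'cd vI]; apply: sO => n ns.
  have vq : `|phi n (v t') - ratr (q n)| <= ratr e'.
    have := vI (cd n, (q n, e', n)); rewrite /tube/= => /(_ _ (\val t')).
    by rewrite to_time_val; apply; [exact: map_f|exact: t'cd].
  have := qx n => xq.
  rewrite (_ : _ - _ = (phi n (v t') - ratr (q n)) - (phi n (w t) - ratr (q n))).
    rewrite (le_lt_trans (ler_normB _ _))//.
    by rewrite (le_lt_trans (lerD vq (ltW xq)))//; lra.
  by rewrite opprB addrA subrK.
split; last by exists I.
rewrite /=.
have cdt n : nbhs t [set t' : time R | ratr (cd n).1 < \val t' < ratr (cd n).2].
  have /andP[h1 h2] := (cdP n).1.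
  have : nbhs t0 (`](ratr (cd n).1), (ratr (cd n).2)[%classic : set R).
    apply: open_nbhs_nbhs; split; first exact: interval_open.
    by rewrite /= in_itv/= h1.
  move=> /time_val_continuous nt; apply: (@filterS _ (nbhs t) _ _ _ _ nt) => t' /=.
  by rewrite in_itv.
elim: s {sO I Iw} => [|n s IHs]; first by apply: (filterS _ filterT).
apply: (@filterS _ (nbhs t) _ _ _ _ (filterI (cdt n) IHs)) => t' [h1 h2] m.
by rewrite inE => /predU1P[->//|]; exact: h2.
Qed.

(* The tubes around [w] generate a filter that converges to [w]; near coverings
   replace the extraction of finite subcovers of the compact set of times. *)
Let tubes_cvg (w : Omega) (U : set Omega) : open U -> U w ->
  exists2 I, tubes I w & tubes I `<=` U.
Proof.
move=> [B oB <-] Bw.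
suff : @path_fun R X @ tubes_filter w --> (@path_fun R X w : {compact-open, time R -> X}).
  move=> /(_ B); apply; apply: open_nbhs_nbhs; split => //.
have FF := fmap_filter (@path_fun R X) (tubes_filterP w).
apply/compact_open_cvgP => K O cK oO KO.
have /compact_near_coveringP ncK := cK.
have := ncK Omega (tubes_filter w) (fun v t => O (v t)) (tubes_filterP w).
move=> /(_ _)[t Kt|I Iw IKO].
  by apply: tubes_near => //; apply: KO; exists t.
by exists I => // v vI _ [t Kt <-]; exact: IKO.
Qed.

Lemma borel_generated_by_cylinders : @measurable _ (borel Omega) `<=`
  <<s [set B : set Omega | exists2 f, range cylinder f &
    exists a, B = [set x | f x < a]] >>.
Proof.
set G := [set B | _].
pose O' := g_sigma_algebraType G.
have mphi (q : rat) n :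
    measurable_fun [set: O'] ((fun w : Omega => phi n (w (to_time (ratr q)))) : O' -> R).
  apply: (measurability (@RGenInftyO.G R)) => [|_ [_ [a ->] <-]].
    exact: RGenInftyO.measurableE.
  rewrite setTI; apply: sub_gen_smallest; exists (cylinder [:: (q, n)]) => //.
  by exists a; apply/seteqP; split=> w /=; rewrite /cylinder big_seq1 in_itv.
have mtube i : measurable (tube i : set O').
  rewrite (_ : tube i = \bigcap_(r : rat)
    if i.1.1 < r < i.1.2 then
    [set w : O' | `|phi i.2.2 ((w : Omega) (to_time (ratr r))) - ratr i.2.1.1|
       <= ratr i.2.1.2] else setT); last first.
    apply/seteqP; split=> w /=.
      by move=> wi r _; case: ifP => // ir; apply: wi; rewrite !ltr_rat.
    (* A violation at a real time persists on an open set of times, which contains a rational. *)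
    move=> wi r0 /andP[ir ri]; rewrite leNgt; apply/negP => lt_phi.
    pose f r := `|phi i.2.2 ((w : Omega) (to_time r)) - ratr i.2.1.1|.
    have cf : continuous f.
      move=> r; apply: cvg_norm; apply: cvgB; last exact: cvg_cst.
      exact: path_observable_continuous.
    pose V := [set r : R | ratr i.2.1.2 < f r] `&` `](ratr i.1.1), (ratr i.1.2)[.
    have oV : open V.
      apply: openI; last exact: interval_open.
      by apply: (@open_comp _ _ f [set y | ratr i.2.1.2 < y]) => //; exact: open_gt.
    have V0 : V !=set0 by exists r0; split => //=; rewrite in_itv/= ir.
    have [y [[/= + +] [r _ rE]]] := @dense_rat R V V0 oV.
    rewrite in_itv/= -{y}rE => fr; rewrite !ltr_rat => cd.
    by have := wi r I; rewrite cd /= leNgt -/(f (ratr r)) fr.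
  apply: countable_bigcapT_measurable => r; case: ifP => // _.
  rewrite (_ : [set w | _] = setT `&`
    (fun w : O' => `|phi i.2.2 ((w : Omega) (to_time (ratr r))) - ratr i.2.1.1|)
      @^-1` `]-oo, ratr i.2.1.2]); last first.
    by rewrite setTI; apply/seteqP; split=> y /=; rewrite in_itv.
  suff : measurable_fun setT
    (fun w : O' => `|phi i.2.2 ((w : Omega) (to_time (ratr r))) - ratr i.2.1.1|).
    by apply => //; exact: measurable_itv.
  apply: measurableT_comp => //.
  by apply: measurable_funB => //; exact: measurable_cst.
have mtubes I : measurable (tubes I : set O').
  rewrite (_ : tubes I = \bigcap_i (if i \in I then tube i else setT)); last first.
    apply/seteqP; split=> y /=; first by move=> yi j _; case: ifP => // /yi.
    by move=> yi j ji; have := yi j Logic.I; rewrite ji.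
  by apply: countable_bigcapT_measurable => j; case: ifP.
apply: smallest_sub; first exact: (@sigma_algebra_measurable _ O').
move=> U oU.
rewrite (_ : U = \bigcup_I if `[< tubes I `<=` U >] then tubes I else set0).
  apply: (@countable_bigcupT_measurable _ O') => [|i]; first exact: countableP.
  by case: ifP => // _; exact: measurable0.
apply/seteqP; split=> w; last first.
  by move=> [i _]; case: asboolP => // bO /bO.
move=> /(tubes_cvg oU)[I Iw IU].
by exists I => //; rewrite asboolT.
Qed.

Lemma cylinder_mul L L' : cylinder L \* cylinder L' = cylinder (L ++ L').
Proof. by apply/funext => w; rewrite /cylinder/= big_cat. Qed.

Let range_cylinder_bounded_measurable :
  range cylinder `<=` @bounded_measurable _ (borel Omega) R.
Proof. by move=> _ [L _ <-]; exact/Cb_bounded_measurable/cylinder_Cb. Qed.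

Let range_cylinder_mul f g : range cylinder f -> range cylinder g ->
  range cylinder (fun x => f x * g x).
Proof.
by move=> [L _ <-] [L' _ <-]; exists (L ++ L') => //; rewrite -cylinder_mul.
Qed.

Lemma law_eq_cylinder (P Q : law R Omega) :
  (forall L, law_mean P (cylinder L) = law_mean Q (cylinder L)) -> P = Q.
Proof.
move=> PQ; apply/law_eqP => A mA.
apply: (@determining_class_eq _ (borel Omega) R (range cylinder)
  range_cylinder_bounded_measurable range_cylinder_mul
  borel_generated_by_cylinders (law_prob P) (law_prob Q) _ A mA).
by move=> _ [L _ <-]; exact: PQ.
Qed.

Lemma kernel_measurable_cylinder d (Y : measurableType d) (p : Y -> law R Omega) :
  (forall L, measurable_fun setT (fun y => law_mean (p y) (cylinder L))) ->
  forall A : set (borel Omega), measurable A -> measurable_fun setT (fun y => p y A).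
Proof.
move=> mp A mA.
apply: (@determining_class_measurable _ (borel Omega) R (range cylinder)
  range_cylinder_bounded_measurable range_cylinder_mul
  borel_generated_by_cylinders _ Y (fun y => law_prob (p y)) _ A mA).
by move=> _ [L _ <-]; exact: mp.
Qed.

End cylinders.

(** * Laplace transforms *)

Section laplace.
Context {R : realType}.
Local Notation leb := (@lebesgue_measure R).
Implicit Types (l s t : R) (g u : R -> R).

Definition laplace l g : R := \int[leb]_(t in `[0, +oo[) (expR (- l * t) * g t).

Let mexp l : measurable_fun [set: R] (fun t => expR (- l * t)).
Proof.
by apply: measurableT_comp => //.
Qed.

Let expR_integrable l : 0 < l ->
  leb.-integrable `[0, +oo[ (EFin \o (fun t => expR (- l * t))).
Proof.
have mI : measurable (`[0, +oo[%classic : set (measurableTypeR R)) by exact: measurable_itv.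
move=> l0; have h1 := integrableS (@measurableT _ (measurableTypeR R)) mI (@subsetT _ _)
  (integrable_exponential_pdf l0).
have := integrableZl mI l^-1 h1.
apply: eq_integrable => // t; rewrite inE/= in_itv/= andbT => t0.
by rewrite exponential_pdfE// -EFinM mulrA mulVf ?gt_eqF// mul1r.
Qed.

Lemma laplace_integrable l g : 0 < l -> bounded_measurable g ->
  leb.-integrable `[0, +oo[ (EFin \o (fun t => expR (- l * t) * g t)).
Proof.
move=> l0 [mg [B gB]].
have mI : measurable (`[0, +oo[%classic : set (measurableTypeR R)) by exact: measurable_itv.
have := integrableZl mI B (expR_integrable l0).
apply: le_integrable => //.
  apply/measurable_EFinP/measurable_funTS.
  by apply: measurable_funM => //; exact: mexp.
move=> t _; rewrite /= lee_fin normrM ger0_norm ?expR_ge0// mulrC.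
rewrite normrM [X in _ <= _ * X]ger0_norm ?expR_ge0// ler_wpM2r ?expR_ge0//.
exact: le_trans (gB t) (ler_norm _).
Qed.

Lemma laplaceD l g u : 0 < l -> bounded_measurable g -> bounded_measurable u ->
  laplace l (fun t => g t + u t) = laplace l g + laplace l u.
Proof.
move=> l0 bg bu; rewrite /laplace -RintegralD//; try exact: laplace_integrable.
by apply: eq_Rintegral => t _; rewrite mulrDr.
Qed.

Lemma laplaceZ l c g : 0 < l -> bounded_measurable g ->
  laplace l (fun t => c * g t) = c * laplace l g.
Proof.
move=> l0 bg; rewrite /laplace -RintegralZl//; last exact: laplace_integrable.
by apply: eq_Rintegral => t _; rewrite mulrCA.
Qed.

Lemma laplaceN l g : 0 < l -> bounded_measurable g ->
  laplace l (fun t => - g t) = - laplace l g.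
Proof.
move=> l0 bg; rewrite -[RHS]mulN1r -laplaceZ//.
by apply: eq_Rintegral => t _; rewrite mulN1r.
Qed.

Lemma le_laplace l g u : 0 < l -> bounded_measurable g -> bounded_measurable u ->
  (forall t, 0 <= t -> g t <= u t) -> laplace l g <= laplace l u.
Proof.
move=> l0 bg bu gu; apply: le_Rintegral => //; try exact: laplace_integrable.
by move=> t /=; rewrite in_itv/= andbT => t0; rewrite ler_wpM2l ?expR_ge0// gu.
Qed.

Lemma eq_laplace l g u : (forall t, 0 <= t -> g t = u t) -> laplace l g = laplace l u.
Proof.
move=> gu; apply: eq_Rintegral => t; rewrite inE/= in_itv/= andbT => t0.
by rewrite gu.
Qed.

Lemma laplace_bounded l g B : 0 < l -> measurable_fun setT g ->
  (forall t, `|g t| <= B) -> `|laplace l g| <= B * laplace l (fun=> 1).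
Proof.
move=> l0 mg gB; have bg : bounded_measurable g by split => //; exists B.
have b1 c : bounded_measurable (fun _ : R => c : R) by exact: bounded_measurable_cst.
rewrite ler_norml; apply/andP; split.
  rewrite -mulNr -laplaceZ//; apply: le_laplace => // t _.
  by have := gB t; rewrite mulr1 ler_norml => /andP[].
rewrite -laplaceZ//; apply: le_laplace => // t _.
by have := gB t; rewrite mulr1 ler_norml => /andP[].
Qed.

Lemma laplace_cvg l (g_ : nat -> R -> R) g B : 0 < l ->
  (forall n, measurable_fun setT (g_ n)) -> (forall n t, `|g_ n t| <= B) ->
  (forall t, g_ n t @[n --> \oo] --> g t) ->
  laplace l (g_ n) @[n --> \oo] --> laplace l g.
Proof.
move=> l0 mg gB gc.
have bg := bounded_measurable_limit mg gB gc.
have bg_ n : bounded_measurable (g_ n) by split => //; exists B.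
have intg h : bounded_measurable h ->
    (\int[leb]_(t in `[0%R, +oo[) (expR (- l * t) * h t)%:E)%E \is a fin_num.
  by move=> bh; apply: integrable_fin_num => //; exact: laplace_integrable.
suff : (\int[leb]_(t in `[0%R, +oo[) (expR (- l * t) * g_ n t)%:E)%E @[n --> \oo] -->
    (laplace l g)%:E by move=> /fine_cvgP[_].
rewrite /laplace /Rintegral fineK; last exact: intg.
have mI : measurable (`[0, +oo[%classic : set (measurableTypeR R)) by exact: measurable_itv.
apply: (@dominated_cvg _ _ _ _ _ mI
  (fun n t => (expR (- l * t) * g_ n t)%:E) _ (fun t => (expR (- l * t) * B)%:E)).
- move=> n; apply/measurable_EFinP/measurable_funTS.
  by apply: measurable_funM; [exact: mexp|exact: mg].
- move=> t _; apply/fine_cvgP; split; first by near=> n.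
  by apply: cvgM; [exact: cvg_cst|exact: gc].
- by [].
- by apply: (@laplace_integrable l (fun=> B)) => //; exact: bounded_measurable_cst.
- move=> n t _; rewrite abse_EFin lee_fin normrM ger0_norm ?expR_ge0//.
  by rewrite ler_wpM2l ?expR_ge0.
Unshelve. all: by end_near. Qed.

Lemma lebesgue_measure_translation s (A : set R) : measurable A ->
  pushforward leb (fun t => s + t : measurableTypeR R) A = leb A.
Proof.
move=> mA; apply/esym/lebesgue_measure_unique => //.
  by apply: measurable_funD => //; exact: measurable_cst.
move=> mT _ [[a b]] _ <-.
transitivity (leb `](a - s), (b - s)]); last first.
  congr (leb _).
  by apply/seteqP; split=> t /=; rewrite !in_itv/= ltrBlDl lerBrDl.
rewrite !lebesgue_measure_itv/= !lte_fin ltrD2r.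
by case: ifP => // _; rewrite -!EFinD; congr EFin; ring.
Qed.

Let bounded_measurable_translate s g : bounded_measurable g ->
  bounded_measurable (fun t => g (s + t)).
Proof.
move=> [mg [B gB]]; split; last by exists B.
apply: (measurableT_comp mg).
by apply: measurable_funD => //; exact: measurable_cst.
Qed.

Lemma laplace_translate l s g : 0 < l -> 0 <= s -> bounded_measurable g ->
  laplace l g = \int[leb]_(t in `[0, s]) (expR (- l * t) * g t) +
    expR (- l * s) * laplace l (fun t => g (s + t)).
Proof.
move=> l0 s0 bg.
have mI : measurable (`[0, +oo[%classic : set (measurableTypeR R)) by exact: measurable_itv.
have mIs : measurable (`[s, +oo[%classic : set (measurableTypeR R)) by exact: measurable_itv.
pose f t := expR (- l * t) * g t.
have intf : leb.-integrable `[0, +oo[ (EFin \o f) by exact: laplace_integrable.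
have : \int[leb]_(t in `[0, +oo[) f t - \int[leb]_(t in `[0, s]) f t =
    \int[leb]_(t in `]s, +oo[) f t.
  by apply: Rintegral_itvB => //; rewrite bnd_simp.
have intfs : leb.-integrable `]s, +oo[ (EFin \o f).
  apply: integrableS intf => //.
  by apply: subset_itvr; rewrite bnd_simp.
rewrite Rintegral_itv_obnd_cbnd//.
move=> /(congr1 (fun y => y + \int[leb]_(t in `[0, s]) f t)); rewrite subrK.
rewrite addrC => lE; transitivity (\int[leb]_(t in `[0, +oo[) f t) => //.
rewrite {}lE; congr (_ + _).
rewrite -laplaceZ//; last exact: bounded_measurable_translate.
pose T (t : measurableTypeR R) : measurableTypeR R := s + t.
have mT : measurable_fun setT T.
  by apply: measurable_funD => //; exact: measurable_cst.
have TI : T @^-1` `[s, +oo[ = `[0, +oo[%classic.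
  by apply/seteqP; split=> t /=; rewrite /T !in_itv/= !andbT lerDl.
have mf : measurable_fun setT f.
  by have [mg _] := bg; apply: measurable_funM; [exact: mexp|exact: mg].
have intfT : leb.-integrable (T @^-1` `[s, +oo[) ((EFin \o f) \o T).
  rewrite TI.
  have := laplace_integrable l0 (bounded_measurableZ (expR (- l * s))
    (bounded_measurable_translate s bg)).
  apply: eq_integrable => // t _ /=.
  by rewrite /f /T mulrA -expRD addrC -mulrDr.
rewrite /Rintegral; congr fine.
transitivity (\int[pushforward leb T]_(t in `[s, +oo[) (f t)%:E)%E.
  by apply: eq_measure_integral => A mA _; exact/esym/lebesgue_measure_translation.
rewrite (integral_pushforward mT)//; last exact/measurable_EFinP.
rewrite TI; apply: eq_integral => t _ /=.
by rewrite /f /T mulrA -expRD addrC -mulrDr.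
Qed.

(* The functions [t |-> exp (- n t)] form a multiplicative class, which generates
   the half-lines. *)
Lemma laplace_half_line l u : 0 < l -> bounded_measurable u ->
  (forall m, l <= m -> laplace m u = 0) ->
  forall c, 0 <= c -> laplace l (fun t => u t * (c < `|t|)%R%:R) = 0.
Proof.
move=> l0 bu u0 c c0.
pose E := [set g : R -> R | bounded_measurable g /\ laplace l (fun t => u t * g t) = 0].
(* The absolute value bounds [e n] on the whole line and changes nothing on the half-line of
   integration. *)
pose e (n : nat) := fun t : R => expR (- n%:R * `|t|).
have indicE' t : (c < `|t|)%R%:R = \1_[set t | c < `|t|] t :> R.
  by rewrite indicE; congr ((nat_of_bool _)%:R); apply/idP/idP; rewrite inE.
suff : E (\1_[set t | c < `|t|]).
  by case=> _ <-; apply: eq_Rintegral => t _; rewrite indicE'.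
have me n : measurable_fun setT (e n).
  apply: measurableT_comp => //.
  by apply: measurable_funM => //; exact: measurable_cst.
have e1 n t : `|e n t| <= 1.
  by rewrite ger0_norm ?expR_ge0// -expR0 ler_expR mulNr oppr_le0 mulr_ge0.
have eb n : bounded_measurable (e n) by split => //; exists 1.
apply: (@monotone_class R _ E (range e)) => //.
- move=> f g [bf Ef] [bg Eg]; split; first exact: bounded_measurableD.
  under [X in laplace l X]eq_fun do rewrite mulrDr.
  by rewrite laplaceD ?Ef ?Eg ?addr0//; exact: bounded_measurableM.
- move=> k f [bf Ef]; split; first exact: bounded_measurableZ.
  under [X in laplace l X]eq_fun do rewrite mulrCA.
  by rewrite laplaceZ ?Ef ?mulr0//; exact: bounded_measurableM.
- move=> f_ f B Ef fB cf.
  have mf n : measurable_fun setT (f_ n) by have [[]] := Ef n.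
  split; first exact: bounded_measurable_limit mf fB cf.
  have [mu [D uD]] := bu.
  have : laplace l (fun t => u t * f_ n t) @[n --> \oo] --> laplace l (fun t => u t * f t).
    apply: (@laplace_cvg _ _ _ (D * B)) => //.
    + by move=> n; exact: measurable_funM.
    + by move=> n t; rewrite normrM ler_pM.
    + by move=> t; apply: cvgM; [exact: cvg_cst|exact: cf].
  move=> h; apply: (cvg_unique _ h); first exact: norm_hausdorff.
  rewrite (_ : (fun n => _) = fun=> 0); first exact: cvg_cst.
  by apply/funext => n; have [] := Ef n.
- move=> _ [n _ <-]; split => //.
  (* Multiplication by [e n] moves the parameter to [l + n], where the transform of [u] vanishes. *)
  rewrite -[RHS](u0 (l + n%:R)) ?lerDl//; apply: eq_Rintegral => t.
  rewrite inE/= in_itv/= andbT => t0.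
  rewrite mulrCA /e ger0_norm// -expRD [RHS]mulrC.
  by congr (_ * expR _); ring.
- by exists 0%N => //; apply/funext => t; rewrite /e oppr0 mul0r expR0.
- move=> _ _ [n _ <-] [m _ <-]; exists (n + m)%N => //; apply/funext => t.
  by rewrite /e -expRD natrD; congr expR; ring.
- by move=> _ [n _ <-]; exists 1.
- apply: sub_sigma_algebra; exists (e 1%N); first by exists 1%N.
  exists (expR (- c)); apply/seteqP; split=> t /=.
    by rewrite /e ltr_expR mulN1r ltrN2.
  by rewrite /e ltr_expR mulN1r ltrN2.
Qed.

(** If [u t > 0], then [u] exceeds [u t / 2] on some []t, t + d2]], whose indicator [J] is a
    difference of two half-line indicators; the transform of [u * J] would be both zero and
    positive. The one-sided conclusion suffices, since it can be applied to a difference of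
    marginals in both orders. *)
Lemma laplace_uniqueness l u : 0 < l -> continuous u -> bounded_fun u ->
  (forall m, l <= m -> laplace m u = 0) -> forall t, 0 <= t -> u t <= 0.
Proof.
move=> l0 cu bu u0 t t0; rewrite leNgt; apply/negP => ut.
have mu : bounded_measurable u by split => //; exact: continuous_measurable_fun.
have : \forall x \near t, u t / 2 < u x.
  apply: (cvgr_gt (u t) (cu t)).
  by rewrite ltr_pdivrMr// ltr_pMr// ltr1n.
move=> /nbhs_ballP[d /= d0 dP].
pose d2 := d / 2.
have d20 : 0 < d2 by rewrite divr_gt0.
pose I c (x : R) : R := (c < `|x|)%R%:R.
have mI c : bounded_measurable (I c).
  split; last by exists 1 => x; rewrite /I; case: (c < _); rewrite ?normr0 ?normr1.
  rewrite (_ : I c = \1_[set x : R | c < `|x|]); last first.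
    apply/funext => x; rewrite indicE; congr ((nat_of_bool _)%:R).
    by apply/idP/idP; rewrite inE.
  apply: measurable_indic.
  rewrite (_ : [set x | _] = setT `&` (fun x : R => `|x|) @^-1` `]c, +oo[).
    suff : measurable_fun setT (fun x : R => `|x|) by apply => //; exact: measurable_itv.
    exact: measurableT_comp.
  by rewrite setTI; apply/seteqP; split=> x /=; rewrite in_itv/= andbT.
pose J x := I t x - I (t + d2) x.
have bJ : bounded_measurable J.
  by apply: bounded_measurableD => //; exact: bounded_measurableN.
have JE x : 0 <= x -> J x = (\1_`]t, (t + d2)] x : R).
  move=> x0; rewrite /J /I !(ger0_norm x0) indicE.
  have -> : (x \in `]t, (t + d2)]%classic) = (t < x <= t + d2).
    by apply/idP/idP; rewrite inE/= in_itv.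
  have [xd|xd] := ltP (t + d2) x.
    by rewrite (lt_trans _ xd) ?ltrDl// subrr.
  by rewrite subr0 andbT.
have uJ0 : laplace l (fun x => u x * J x) = 0.
  under [X in laplace l X]eq_fun do rewrite mulrBr -mulrN.
  rewrite (laplaceD l0 (g := fun x => u x * I t x)); last 2 first.
  - exact: bounded_measurableM.
  - by apply: bounded_measurableM => //; exact: bounded_measurableN.
  under [X in _ + laplace l X]eq_fun do rewrite mulrN.
  rewrite laplaceN//; last exact: bounded_measurableM.
  by rewrite !laplace_half_line// ?subr0// addr_ge0// ltW.
suff : 0 < laplace l (fun x => u x * J x) by rewrite uJ0 ltxx.
apply: (@lt_le_trans _ _ (laplace l (fun x => (u t / 2) * J x))); last first.
  apply: le_laplace => //; try exact: bounded_measurableM.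
    exact: bounded_measurableZ.
  move=> x x0; rewrite JE// indicE.
  case: (boolP (x \in _)); rewrite ?mulr0// !mulr1 inE/= in_itv/= => /andP[tx xd].
  apply/ltW/dP; rewrite /ball/= ltr_distlC; apply/andP; split; first lra.
  by rewrite /d2 in xd; lra.
rewrite laplaceZ// pmulr_rgt0 ?divr_gt0//.
have mA : measurable (`]t, (t + d2)]%classic : set (measurableTypeR R)) by exact: measurable_itv.
have mI0 : measurable (`[0, +oo[%classic : set (measurableTypeR R)) by exact: measurable_itv.
have intA : leb.-integrable `[0, +oo[ (EFin \o (\1_`]t, (t + d2)] : R -> R)).
  apply: (integrableS (@measurableT _ (measurableTypeR R)) mI0 (@subsetT _ _)).
  apply: integrable_indic_itv.
apply: (@lt_le_trans _ _
  (\int[leb]_(x in `[0, +oo[) (expR (- l * (t + d2)) * \1_`]t, (t + d2)] x))).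
  rewrite RintegralZl// pmulr_rgt0 ?expR_gt0// /Rintegral integral_indic//.
  rewrite (_ : _ `&` _ = `]t, (t + d2)]%classic); last first.
    apply/seteqP; split=> x /=; rewrite !in_itv/= andbT; first by case.
    by move=> /andP[tx xd]; rewrite tx xd; split => //; exact: ltW (le_lt_trans t0 tx).
  rewrite -[ltRHS]/(fine (leb `]t, (t + d2)])).
  have -> // : leb `]t, (t + d2)] = d2%:E.
  by rewrite lebesgue_measure_itv/= lte_fin ltrDl d20 -EFinB addrC addKr.
apply: le_Rintegral => //; first exact: (integrableZl mI0 _ intA).
  exact: laplace_integrable.
move=> x /=; rewrite in_itv/= andbT => x0; rewrite JE// indicE.
case: (boolP (x \in _)); rewrite ?mulr0// !mulr1 inE/= in_itv/= => /andP[tx xd].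
by rewrite ler_expR !mulNr lerN2 ler_pM2l.
Qed.

End laplace.

Section caratheodory.
Context {d} {T : measurableType d} {R : realType}.

(** Rounding [r] down to a multiple of [1 / (n + 1)] leaves countably many slabs on which [h]
    depends on the first argument only; continuity in [r] recovers [h] in the limit. *)
Lemma caratheodory_measurable (h : T -> R -> R) :
  (forall r, measurable_fun setT (h ^~ r)) -> (forall w, continuous (h w)) ->
  measurable_fun [set: T * measurableTypeR R] (fun z => h z.1 z.2).
Proof.
move=> mh ch.
pose e n (r : R) : R := (Num.floor (r * n.+1%:R))%:~R / n.+1%:R.
have e_cvg r : e n r @[n --> \oo] --> r.
  apply: (@squeeze_cvgr _ _ _ _ (fun n => r - n.+1%:R^-1) (fun=> r)).
  - near=> n; rewrite /e ler_pdivrMr// floor_le andbT ler_pdivlMr//.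
    rewrite mulrBl mulVf ?pnatr_eq0// lerBlDr.
    by have := floorD1_gt (r * n.+1%:R); rewrite intrD => /ltW.
  - rewrite -[X in _ --> X]subr0.
    by apply: cvgB; [exact: cvg_cst|exact: cvg_harmonic].
  - exact: cvg_cst.
apply: (@measurable_fun_cvg _ _ _ _ (fun n z => h z.1 (e n z.2))).
  move=> n _ B mB; rewrite setTI.
  pose I (k : int) : set (measurableTypeR R) := `[k%:~R / n.+1%:R, (k + 1)%:~R / n.+1%:R[%classic.
  rewrite (_ : _ @^-1` B =
    \bigcup_(k : int) ((h ^~ (k%:~R / n.+1%:R)) @^-1` B `*` I k)).
    apply: countable_bigcupT_measurable => [|k]; first exact: countableP.
    apply: measurableX; last exact: measurable_itv.
    by rewrite -[X in measurable X]setTI; exact: mh.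
  have eI (r : R) k : I k r <-> Num.floor (r * n.+1%:R) = k.
    rewrite /I /= in_itv/= ler_pdivrMr// ltr_pdivlMr//.
    by rewrite -floor_eq; split => [/eqP|->].
  apply/seteqP; split=> [[w r] /= hB|[w r] [k _ [/= hB /eI rk]]].
    by exists (Num.floor (r * n.+1%:R)) => //; split => //; exact/eI.
  by rewrite /e rk.
move=> [w r] _ /=; apply: (cvg_comp _ _ (e_cvg r)); exact: ch.
Unshelve. all: by end_near. Qed.

End caratheodory.

(** * Laplace functionals on the path space *)

Section path_laplace.
Context {R : realType} {X : ptopologicalType}.
Local Notation Omega := (path_space R X).
Local Notation leb := (@lebesgue_measure R).
Implicit Types (P Q : law R Omega) (f : Omega -> R) (s t : time R).

(** Time is locally compact: the image under [to_time] of a small segment around [t] is a compact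
    neighbourhood that [w] maps into [O], and it defines the compact-open neighbourhood of [w]. *)
Lemma path_near (w : Omega) t (O : set X) : open O -> O (w t) ->
  \forall t' \near t & v \near w, O ((v : Omega) t').
Proof.
move=> oO Owt.
have : nbhs (\val t) ((fun r : R => w (to_time r)) @^-1` O).
  by apply: path_to_time_continuous; rewrite to_time_val; exact: open_nbhs_nbhs.
move=> /nbhs_ballP[d /= d0 dO].
pose d2 := d / 2.
have d20 : 0 < d2 by rewrite divr_gt0.
pose K := @to_time R @` `[\val t - d2, \val t + d2].
have cK : compact K.
  apply: continuous_compact; last exact: segment_compact.
  exact/continuous_subspaceT/to_time_continuous.
have oW := compact_open_open cK oO.
exists (K, @path_fun R X @^-1` [set g | g @` K `<=` O]); last first.
  by move=> [t' v] [/= Kt' vK]; apply: vK; exists t'.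
split => /=; last first.
  apply: open_nbhs_nbhs; split; first by exists [set g | g @` K `<=` O].
  move=> _ [_ [r rt <-] <-]; apply: dO; rewrite /ball/= ltr_distlC.
  by move: rt; rewrite /= in_itv/= /d2 => /andP[? ?]; apply/andP; split; lra.
have /time_val_continuous nt : nbhs (\val t) (ball (\val t) d2) by exact: nbhsx_ballx.
apply: (@filterS _ (nbhs t) _ _ _ _ nt) => t' /=.
rewrite /ball/= ltr_distlC => /andP[h1 h2].
by exists (\val t'); rewrite ?to_time_val//= in_itv/= !ltW.
Qed.

Lemma law_mean_shift s P f : @bounded_measurable _ (borel Omega) R f ->
  law_mean (shift_law s P) f = law_mean P (fun w => f (shift_path s w)).
Proof.
move=> bf; rewrite /law_mean /Rintegral; congr fine.
transitivity (\int[pushforward (law_prob P) (@borel_shift_path R X s)]_w (f w)%:E)%E.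
  by apply: eq_measure_integral => A mA _; exact: shift_lawE.
rewrite integral_pushforward//=; first by apply/measurable_EFinP; case: bf.
apply: (@bounded_measurable_integrable _ _ _ P (fun w => f (shift_path s w))).
have [mf [B fB]] := bf; split; last by exists B.
exact: (measurableT_comp mf (@shift_measurable R X s)).
Qed.

Section observable.
Variable phi : X -> R.
Hypothesis phi_Cb : Cb phi.

Let phi_cont : continuous phi. Proof. by have /CbP[] := phi_Cb. Qed.

Definition path_laplace l (w : Omega) : R := laplace l (fun r => phi (w (to_time r))).

Definition marginal P (r : R) : R := law_mean P (fun w => phi (w (to_time r))).

Let path_bounded_measurable (w : Omega) : bounded_measurable (fun r : R => phi (w (to_time r))).
Proof.
have /CbP[_ [B phiB]] := phi_Cb; split; last by exists B.
by apply: continuous_measurable_fun; exact: path_observable_continuous.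
Qed.

Let observable_Cb r : Cb (fun w : Omega => phi (w (to_time r))).
Proof. exact: evaluation_Cb. Qed.

Lemma marginal_bounded P : bounded_fun (marginal P).
Proof.
have /CbP[_ [B phiB]] := phi_Cb; exists B => r; apply: mean_bounded => //.
by have [] := Cb_bounded_measurable (observable_Cb r).
Qed.

Lemma marginal_continuous P : continuous (marginal P).
Proof.
move=> r; apply/(@cvg_nbhsP _ R^o) => u ur.
have /CbP[_ [B phiB]] := phi_Cb.
apply: (@mean_cvg _ (borel Omega) R (law_prob P)
  (fun n w => phi ((w : Omega) (to_time (u n)))) _ B) => //.
  by move=> n; have [] := Cb_bounded_measurable (observable_Cb (u n)).
move=> w.
by apply: (@cvg_comp _ _ _ u (fun r => phi (w (to_time r))) _ (nbhs r)) => //;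
  exact: path_observable_continuous.
Qed.

Lemma marginal_shift s P r : 0 <= r -> marginal (shift_law s P) r = marginal P (\val s + r).
Proof.
move=> r0; rewrite /marginal law_mean_shift; last exact/Cb_bounded_measurable/observable_Cb.
congr (law_mean P _); apply/funext => w.
transitivity (phi (w (time_add s (to_time r)))) => //.
by rewrite /time_add /= (max_r r0).
Qed.

(** Closeness of the observable uniformly on [[0, T]] holds near [w] in the compact-open topology,
    and the exponential weight makes the rest of the integral small for all paths at once. *)
Lemma path_laplace_Cb l : 0 < l -> Cb (path_laplace l).
Proof.
move=> l0; have /CbP[_ [B phiB]] := phi_Cb; apply/CbP; split; last first.
  exists (B * laplace l (fun=> 1)) => w; apply: laplace_bounded => //.
  by apply: continuous_measurable_fun; exact: path_observable_continuous.
have b1 c : bounded_measurable (fun _ : R => c : R) by exact: bounded_measurable_cst.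
pose c1 := laplace l (fun=> 1).
have c10 : 0 <= c1.
  by apply: Rintegral_ge0 => r _; rewrite mulr1 expR_ge0.
have B0 : 0 <= B by exact: le_trans (normr_ge0 _) (phiB point).
have bH T : bounded_measurable (fun r : R => (T < r)%R%:R : R).
  split; last by exists 1 => x; case: (T < _); rewrite ?normr0 ?normr1.
  rewrite (_ : (fun r => _) = \1_(`]T, +oo[)); last first.
    apply/funext => x; rewrite indicE; congr ((nat_of_bool _)%:R).
    by apply/idP/idP; rewrite inE/= in_itv/= andbT.
  by apply: measurable_indic; exact: measurable_itv.
have tail T : 0 <= T -> laplace l (fun r => (T < r)%R%:R) <= expR (- l * T) * c1.
  move=> T0; rewrite (laplace_translate l0 T0)//.
  rewrite (_ : \int[leb]_(t in _) _ = 0) ?add0r.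
    rewrite ler_wpM2l ?expR_ge0//; apply: le_laplace => //.
      by under eq_fun do rewrite ltrDl.
    by move=> t _; case: (_ < _).
  transitivity (\int[leb]_(t in `[0, T]) (0 : R)).
    2: by rewrite Rintegral_cst// mul0r.
  apply: eq_Rintegral => t; rewrite inE/= in_itv/= => /andP[_ tT].
  by rewrite ltNge tT mulr0.
move=> w; have Fw : Filter (nbhs w) := nbhs_filter w.
apply/(@cvgrPdist_le _ _ _ (nbhs w) Fw) => e e0.
(* The final estimate is [q * c1] on [[0, T]] plus [2 * B * (q * c1)] for the tail, that is
   [q * (D - 1)]; the summand 1 keeps [D] positive. *)
pose D := c1 * (1 + 2 * B) + 1.
have D0 : 0 < D by rewrite ltr_wpDl// mulr_ge0// addr_ge0// mulr_ge0.
pose q := e / D.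
have q0 : 0 < q by rewrite divr_gt0.
have [T T0 Tq] : exists2 T, 0 <= T & expR (- l * T) <= q.
  exists (Num.max 0 (- ln q / l)); first by rewrite le_max lexx.
  rewrite -[leRHS](lnK q0) ler_expR mulNr lerNl mulrC -ler_pdivrMr//.
  by rewrite le_max lexx orbT.
have cK : compact (@to_time R @` `[0, T]).
  apply: continuous_compact; last exact: segment_compact.
  exact/continuous_subspaceT/to_time_continuous.
have /compact_near_coveringP ncK := cK.
have := ncK Omega (nbhs w)
  (fun v t => `|phi (w t) - phi ((v : Omega) t)| < q) (nbhs_filter w).
have near_q t : (@to_time R @` `[0, T]) t ->
    \forall t' \near t & v \near w, `|phi (w t') - phi ((v : Omega) t')| < q.
  move=> _; pose O := phi @^-1` (ball (phi (w t)) (q / 2)).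
  have oO : open O by apply: open_comp => //; exact: ball_open.
  have Ow : O (w t) by rewrite /O /=; apply: ballxx; rewrite divr_gt0.
  have [[U V] /= [nU nV] UV] := path_near oO Ow.
  exists (U, V) => // -[t' v] [/= Ut' Vv].
  have h1 : O (w t') by apply: (UV (t', w)); split => //=; exact: nbhs_singleton.
  have h2 : O (v t') by exact: (UV (t', v)).
  rewrite [q]splitr -[X in `|X|](subrKA (phi (w t))).
  rewrite (le_lt_trans (ler_normD _ _))// ltrD//.
  by rewrite distrC.
move=> /(_ near_q); apply: filterS => v vq.
have bw := path_bounded_measurable w; have bv := path_bounded_measurable v.
rewrite /path_laplace -laplaceN// -laplaceD//; last exact: bounded_measurableN.
pose g (r : R) := q + 2 * B * (T < r)%R%:R.
have bg : bounded_measurable g.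
  by apply: bounded_measurableD => //; exact: bounded_measurableZ.
have bwv : bounded_measurable (fun r : R => phi (w (to_time r)) - phi (v (to_time r))).
  by apply: bounded_measurableD => //; exact: bounded_measurableN.
have wvg r : 0 <= r -> `|phi (w (to_time r)) - phi (v (to_time r))| <= g r.
  move=> r0; rewrite /g; have [Tr|rT] := ltP T r.
    rewrite mulr1 (le_trans (ler_normB _ _))//.
    rewrite (le_trans (lerD (phiB _) (phiB _)))//; lra.
  rewrite mulr0 addr0; apply/ltW/vq; exists r => //=.
  by rewrite in_itv/= r0.
have -> : e = q * D by rewrite /q divfK// gt_eqF.
have lg : laplace l g <= q * D.
  rewrite /g (laplaceD l0 (g := fun=> q))//; last exact: bounded_measurableZ.
  rewrite (_ : (fun=> q) = (fun _ : R => q * 1)); last by apply/funext => ?; rewrite mulr1.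
  rewrite !laplaceZ// -/c1.
  have h : laplace l (fun r => (T < r)%R%:R) <= q * c1.
    by apply: le_trans (tail _ T0) _; rewrite ler_wpM2r.
  apply: (@le_trans _ _ (q * c1 + 2 * B * (q * c1))).
    by rewrite lerD2l ler_wpM2l// mulr_ge0.
  rewrite -subr_ge0 (_ : _ - _ = q); first exact: ltW.
  by rewrite /D; ring.
rewrite ler_norml; apply/andP; split.
  rewrite lerNl -laplaceN//; apply: le_trans lg; apply: le_laplace => //.
    exact: bounded_measurableN.
  by move=> r r0; rewrite (le_trans (ler_norm _))// normrN wvg.
apply: le_trans lg; apply: le_laplace => // r r0.
by rewrite (le_trans (ler_norm _))// wvg.
Qed.

End observable.

End path_laplace.

Section laplace_mean.
Context {R : realType} {X : ptopologicalType}.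
Local Notation Omega := (path_space R X).
Local Notation leb := (@lebesgue_measure R).
Implicit Types (P Q : law R Omega) (s t : time R).
Variable phi : X -> R.
Hypothesis phi_Cb : Cb phi.

Let marginal_bounded_measurable P : bounded_measurable (marginal phi P).
Proof.
split; last exact: marginal_bounded.
by apply: continuous_measurable_fun; exact: marginal_continuous.
Qed.

Lemma law_mean_path_laplace l P : 0 < l ->
  law_mean P (path_laplace phi l) = laplace l (marginal phi P).
Proof.
move=> l0; have /CbP[_ [B phiB]] := phi_Cb.
have B0 : 0 <= B by exact: le_trans (normr_ge0 _) (phiB point).
pose I : set (measurableTypeR R) := `[0, +oo[%classic.
have mI : measurable I by exact: measurable_itv.
pose h (w : borel Omega) (r : R) := phi ((w : Omega) (to_time r)).
pose k (z : borel Omega * measurableTypeR R) : R :=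
  expR (- l * z.2) * h z.1 z.2 * \1_I z.2.
have mhr r : measurable_fun setT (h ^~ r).
  by have [] := Cb_bounded_measurable (evaluation_Cb phi_Cb (to_time r)).
have mh : measurable_fun setT (fun z : borel Omega * measurableTypeR R => h z.1 z.2).
  by apply: caratheodory_measurable => // w; exact: path_observable_continuous.
have mk : measurable_fun setT k.
  apply: measurable_funM; last exact: (measurableT_comp (measurable_indic mI)).
  apply: measurable_funM => //; apply: measurableT_comp => //.
  by apply: measurable_funM => //; exact: measurable_cst.
have bh w : bounded_measurable (h w).
  split; last by exists B => r; exact: phiB.
  by apply: continuous_measurable_fun; exact: path_observable_continuous.
have kE (psi : R -> R) (g : R -> \bar R) : bounded_measurable psi ->
    (forall r, I r -> g r = (expR (- l * r) * psi r)%:E) ->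
    (forall r, ~ I r -> g r = 0%E) ->
    (\int[leb]_r g r = (laplace l psi)%:E)%E.
  move=> bpsi gI gN; rewrite /laplace /Rintegral fineK; last first.
    by apply: integrable_fin_num => //; exact: laplace_integrable.
  rewrite [RHS]integral_mkcond; apply: eq_integral => r _; rewrite patchE.
  case: ifPn => rI; first by rewrite gI//; exact: set_mem.
  by rewrite gN// => Ir; move/negP: rI; apply; exact: mem_set.
have kI w r : I r -> k (w, r) = expR (- l * r) * h w r.
  by move=> Ir; rewrite /k/= indicE mem_set// mulr1.
have kN w r : ~ I r -> k (w, r) = 0.
  by move=> Ir; rewrite /k/= indicE memNset// mulr0.
(* The path transform of [aphi] is bounded and equals the inner integral of the absolute value of
   [k], which gives the integrability that Fubini requires. *)
pose aphi x := `|phi x|.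
have aphi_Cb : Cb aphi.
  have /CbP[cphi _] := phi_Cb; apply/CbP; split; last first.
    by exists B => x; rewrite normr_id.
  by move=> x; apply: cvg_norm; exact: cphi.
have bah w : bounded_measurable (fun r => `|h w r|).
  have [mhw _] := bh w; split; first exact: measurableT_comp.
  by exists B => r; rewrite normr_id; exact: phiB.
have intk : ((law_prob P) \x leb)%E.-integrable setT (EFin \o k).
  apply/(@integrable12ltyP _ _ _ _ _ (law_prob P) leb); first exact/measurable_EFinP.
  rewrite (_ : (\int[_]_x \int[_]_y _)%E = \int[P]_w (path_laplace aphi l w)%:E)%E.
    rewrite ltey_eq; apply/orP; left; apply: integrable_fin_num => //.
    apply: (@bounded_measurable_integrable _ _ _ (law_prob P)).
    exact/Cb_bounded_measurable/path_laplace_Cb.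
  apply: eq_integral => w _; apply: (kE (fun r => `|h w r|)) => // r Ir /=.
    by rewrite kI// normrM ger0_norm// expR_ge0.
  by rewrite kN// normr0.
have := Fubini intk.
rewrite (_ : (\int[_]_x \int[_]_y _)%E = \int[P]_w (path_laplace phi l w)%:E)%E; last first.
  apply: eq_integral => w _; apply: (kE (h w)) => // r Ir /=.
    by rewrite kI.
  by rewrite kN.
rewrite /law_mean {1}/Rintegral => ->.
rewrite (kE (marginal phi P))// => r Ir; last first.
  by rewrite integral0_eq// => w _; rewrite /= kN.
have bhr : @bounded_measurable _ (borel Omega) R (h ^~ r).
  split; last by exists B => w; exact: phiB.
  exact: mhr.
transitivity (\int[P]_w (expR (- l * r) * h w r)%:E)%E.
  by apply: eq_integral => w _; rewrite /= kI.
have bher := bounded_measurableZ (expR (- l * r)) bhr.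
rewrite /marginal /law_mean -(meanZ (law_prob P))// /Rintegral fineK//.
apply: integrable_fin_num => //.
exact: (@bounded_measurable_integrable _ _ _ (law_prob P)).
Qed.

(** Competitors with the same shifted law are compared through [zeta] alone, and those with the same
    [zeta] through their shifts; (KP2) acts on both terms at once. *)
Lemma law_mean_path_laplace_zeta l s P : 0 < l ->
  law_mean P (path_laplace phi l) =
  zeta l phi s P + expR (- l * \val s) * law_mean (shift_law s P) (path_laplace phi l).
Proof.
move=> l0; rewrite !law_mean_path_laplace//.
rewrite (laplace_translate l0 (time_ge0 s))//; congr (_ + _ * _).
by apply: eq_laplace => r r0; rewrite marginal_shift.
Qed.

(** The transforms agree on [Lambda] only. Each larger parameter is approached from the right by
    points of [Lambda], and dominated convergence carries the equality over before injectivity is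
    used. *)
Lemma marginal_unique (Lambda : set R) P Q :
  Lambda `<=` `]0, +oo[%classic -> `]0, +oo[%classic `<=` closure Lambda ->
  (forall l, Lambda l -> law_mean P (path_laplace phi l) = law_mean Q (path_laplace phi l)) ->
  forall r, 0 <= r -> marginal phi P r = marginal phi Q r.
Proof.
move=> Lpos Ldense PQ.
have cu (P' Q' : law R Omega) : continuous (fun r => marginal phi P' r - marginal phi Q' r).
  by move=> r; apply: cvgB; exact: marginal_continuous.
have bu (P' Q' : law R Omega) : bounded_fun (fun r => marginal phi P' r - marginal phi Q' r).
  have [B hB] := marginal_bounded phi_Cb P'; have [D hD] := marginal_bounded phi_Cb Q'.
  by exists (B + D) => r; rewrite (le_trans (ler_normB _ _))// lerD.
have main (P' Q' : law R Omega) :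
  (forall l, Lambda l -> law_mean P' (path_laplace phi l) = law_mean Q' (path_laplace phi l)) ->
  forall r, 0 <= r -> marginal phi P' r <= marginal phi Q' r.
  move=> PQ' r r0; rewrite -subr_le0.
  pose u r := marginal phi P' r - marginal phi Q' r.
  have bmu : bounded_measurable u.
    by split; [apply: continuous_measurable_fun; exact: cu|exact: bu].
  (* Injectivity needs only large parameters; [m >= 2] keeps every [l n] above 1, so that
     [exp (- t)] dominates all the weights. *)
  apply: (@laplace_uniqueness _ 2 u) => //; try exact: cu; try exact: bu.
  move=> m m2.
  have /choice[l lP] n : exists l, Lambda l /\ m < l < m + n.+1%:R^-1.
    have mI : `]0, +oo[%classic (m + (2 * n.+1%:R)^-1).
      rewrite /= in_itv/= andbT ltr_pwDl ?invr_ge0//.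
      by rewrite (lt_le_trans _ m2).
    have := Ldense _ mI (`]m, (m + n.+1%:R^-1)[%classic).
    have nb : nbhs (m + (2 * n.+1%:R)^-1) (`]m, (m + n.+1%:R^-1)[%classic : set R).
      apply: open_nbhs_nbhs; split; first exact: interval_open.
      rewrite /= in_itv/= ltrDl invr_gt0 mulr_gt0//= ltrD2l ltf_pV2 ?posrE ?mulr_gt0//.
      by rewrite ltr_pMl// ltr1n.
    by move=> /(_ nb)[l [Ll]]; rewrite /= in_itv/= => ?; exists l.
  have l_cvg : l n @[n --> \oo] --> m.
    apply: (@squeeze_cvgr _ _ _ _ (fun=> m) (fun n => m + n.+1%:R^-1)).
    - by near=> n; have [_ /andP[/ltW -> /ltW]] := lP n.
    - exact: cvg_cst.
    - rewrite -[X in _ --> X]addr0.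
      by apply: cvgD; [exact: cvg_cst|exact: cvg_harmonic].
  have lu0 n : laplace (l n) u = 0.
    have [Ll /andP[ml _]] := lP n.
    have ln0 : 0 < l n by apply: lt_trans ml; rewrite (lt_le_trans _ m2).
    rewrite /u laplaceD//; last exact: bounded_measurableN.
    by rewrite laplaceN// -!law_mean_path_laplace// PQ'// subrr.
  (* [exp (- l t) = exp (- t) * exp (- (l - 1) t)] keeps the integrands dominated *)
  have shiftE l' (g : R -> R) : laplace l' g =
      laplace 1 (fun r : R => expR (- (l' - 1) * `|r|) * g r).
    apply: eq_Rintegral => t; rewrite inE/= in_itv/= andbT => t0.
    by rewrite ger0_norm// mulrA -expRD; congr (expR _ * _); ring.
  have [mu [B uB]] := bmu.
  have h : laplace (l n) u @[n --> \oo] --> laplace m u.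
    rewrite shiftE; under eq_fun do rewrite shiftE.
    apply: (@laplace_cvg _ _ _ _ B) => //.
    + move=> n; apply: measurable_funM => //; apply: measurableT_comp => //.
      by apply: measurable_funM => //; exact: measurable_cst.
    + move=> n t; rewrite normrM ger0_norm ?expR_ge0//.
      have [_ /andP[ml _]] := lP n.
      rewrite -[B]mul1r ler_pM ?expR_ge0// expR_le1 mulNr oppr_le0.
      by rewrite mulr_ge0// subr_ge0 (le_trans _ (ltW ml))// (le_trans _ m2)// ler1n.
    + move=> t; apply: cvgM; last exact: cvg_cst.
      apply: (@cvg_comp _ _ _ (fun n => - (l n - 1) * `|t|) expR _ (nbhs (- (m - 1) * `|t|))).
        apply: cvgM; last exact: cvg_cst.
        by apply: cvgN; apply: cvgB => //; exact: cvg_cst.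
      exact: continuous_expR.
  apply: (cvg_unique _ h); first exact: norm_hausdorff.
  rewrite (_ : (fun n => _) = fun=> 0); first exact: cvg_cst.
  exact/funext.
by move=> r r0; apply/eqP; rewrite eq_le !main// => l Ll; rewrite PQ.
Unshelve. all: by end_near. Qed.

End laplace_mean.

(** * Support functions of lexicographic maximizers *)

Section sup_image.
Context {R : realType} {Y : topologicalType}.
Implicit Types (u v : Y -> R) (A K : set Y).

Lemma sup_image_attained A u : continuous u -> compact A -> A !=set0 ->
  exists2 y, A y & sup (u @` A) = u y.
Proof.
move=> cu cA A0; have [y Ay ymax] := compact_max cu cA A0; exists y => //.
apply/eqP; rewrite eq_le; apply/andP; split.
  by apply: ge_sup; [exists (u y), y|move=> _ [z Az <-]; exact: ymax].
by apply: ub_le_sup; [exists (u y) => _ [z Az <-]; exact: ymax|exists y].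
Qed.

Lemma le_sup_image A u y : continuous u -> compact A -> A y -> u y <= sup (u @` A).
Proof.
move=> cu cA Ay; have A0 : A !=set0 by exists y.
have [m Am mmax] := compact_max cu cA A0.
by apply: ub_le_sup; [exists (u m) => _ [z Az <-]; exact: mmax|exists y].
Qed.

Lemma sup_image_argmax A v y : continuous v -> compact A -> argmax v A y ->
  sup (v @` A) = v y.
Proof.
move=> cv cA [Ay ymax]; apply/eqP; rewrite eq_le le_sup_image// andbT.
by apply: ge_sup; [exists (v y), y|move=> _ [z Az <-]; exact: ymax].
Qed.

(** If the suprema stayed [e] above the limit, the parts of the [K n] where [u] is that large would
    be nested and non-empty. A common point would lie in the intersection and exceed its
    supremum. *)
Lemma sup_image_nested_cvg A (K : nat -> set Y) u : continuous u -> compact A ->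
  (forall n, closed_in A (K n)) -> (forall n, K n.+1 `<=` K n) ->
  (forall n, K n !=set0) ->
  sup (u @` K n) @[n --> \oo] --> sup (u @` \bigcap_n K n).
Proof.
move=> cu cA cK Kd K0.
have Kmono := decreasing_sets Kd.
have cKn n : compact (K n) by exact: closed_in_compact cA (cK n).
have cI : compact (\bigcap_n K n).
  by apply: closed_in_compact cA _; exact: closed_in_bigcap.
have I0 : \bigcap_n K n !=set0 by exact: compact_nested cA cK Kd K0.
have [z Iz zE] := sup_image_attained cu cI I0.
apply/cvgrPdist_lt => e e0.
have [n0 n0P] : exists n0, ~ (K n0 `&` [set y | sup (u @` \bigcap_n K n) + e <= u y] !=set0).
  apply/existsNP => h.
  have [||n|y yK] := compact_nested cA
    (K := fun n => K n `&` [set y | sup (u @` \bigcap_n K n) + e <= u y]).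
  - by move=> n; apply: closed_inI => //; exact: closed_superlevel.
  - by move=> n y [/Kd].
  - exact: h.
  - have Iy : (\bigcap_n K n) y by move=> n _; have [] := yK n I.
    have [_ /=] := yK 0%N I; rewrite leNgt => /negP; apply.
    by rewrite (le_lt_trans (le_sup_image cu cI Iy))// ltrDl.
near=> n.
have [y Ky yE] := sup_image_attained cu (cKn n) (K0 n).
have h1 : sup (u @` \bigcap_n K n) <= sup (u @` K n).
  by rewrite zE; apply: le_sup_image => //; exact: Iz.
rewrite distrC ger0_norm ?subr_ge0// ltrBlDl yE ltNge; apply/negP => ey.
apply: n0P; exists y; split; last by [].
by apply: Kmono Ky; near: n; exact: nbhs_infty_ge.
Unshelve. all: by end_near. Qed.

Lemma measurable_fun_sup_image {d} {X : measurableType d} (C : X -> set Y)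
    (l : Y -> R) : continuous l ->
  (forall x, compact (C x)) -> (forall x, C x !=set0) ->
  hit_measurable C -> measurable_fun setT (fun x => sup (l @` C x)).
Proof.
move=> cl cC C0 mC.
apply: (measurability (@RGenCInfty.G R)); first exact: RGenCInfty.measurableE.
move=> _ [_ [q ->] <-]; rewrite setTI.
rewrite (_ : _ @^-1` _ = [set x | C x `&` [set y | q <= l y] !=set0]).
  by apply: mC; exact: closed_superlevel.
apply/seteqP; split=> x /=; rewrite in_itv/= andbT.
  by have [y Cy ->] := sup_image_attained cl (cC x) (C0 x) => qy; exists y.
by move=> [y [Cy /= qy]]; exact: le_trans qy (le_sup_image cl (cC x) Cy).
Qed.

Section penalized.
Variables (A : set Y) (u v : Y -> R).
Hypotheses (cu : continuous u) (cv : continuous v) (cA : compact A) (A0 : A !=set0).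

Let w (N : nat) y := u y + N%:R * v y.

Let cw N : continuous (w N).
Proof.
move=> y; apply: cvgD; first exact: cu.
by apply: cvgM; [exact: cvg_cst|exact: cv].
Qed.

Let cargmax : compact (argmax v A).
Proof.
apply: closed_in_compact cA _; apply: argmax_closed_in => //.
by exists setT => //; rewrite setIT.
Qed.

Let argmax0 : argmax v A !=set0. Proof. exact: argmax_nonempty. Qed.

(** With the upper bound that follows, this bounds the penalized suprema uniformly in [N], as
    dominated convergence will require. *)
Lemma sup_penalized_ge N :
  sup (u @` argmax v A) <= sup ((fun y => u y + N%:R * v y) @` A) - N%:R * sup (v @` A).
Proof.
have [y yA ->] := sup_image_attained cu cargmax argmax0.
rewrite (sup_image_argmax cv cA yA) lerBrDr.
by apply: (@le_sup_image _ (w N)) => //; have [] := yA.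
Qed.

Lemma sup_penalized_le N :
  sup ((fun y => u y + N%:R * v y) @` A) - N%:R * sup (v @` A) <= sup (u @` A).
Proof.
have [y yA ->] := sup_image_attained (@cw N) cA A0.
by rewrite lerBlDr lerD// ?le_sup_image// ler_wpM2l// le_sup_image.
Qed.

(** The expression is the supremum of [u + N (v - m)], which decreases in [N] on [A] because [m] is
    the maximum of [v]. By compactness, failure to converge gives a point where it stays above
    [c + e] for all [N]; the Archimedean property forces [v = m] there, so the point is a maximizer
    of [v] with [u] above [c]. *)
Lemma sup_penalized_cvg :
  sup ((fun y => u y + N%:R * v y) @` A) - N%:R * sup (v @` A) @[N --> \oo] -->
  sup (u @` argmax v A).
Proof.
set c := sup (u @` argmax v A); set m := sup (v @` A).
apply/cvgrPdist_lt => e e0.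
pose g (N : nat) y := u y + N%:R * (v y - m).
have cg N : continuous (g N).
  move=> y; apply: cvgD; first exact: cu.
  by apply: cvgM; [exact: cvg_cst|apply: cvgB; [exact: cv|exact: cvg_cst]].
have vm y : A y -> v y - m <= 0 by move=> Ay; rewrite subr_le0 le_sup_image.
have gd n k y : (n <= k)%N -> A y -> g k y <= g n y.
  by move=> nk Ay; rewrite lerD2l ler_wnM2r ?vm// ler_nat.
have [n0 n0P] : exists n0, ~ (A `&` [set y | c + e <= g n0 y] !=set0).
  apply/existsNP => h.
  have [|||y yK] := compact_nested cA (K := fun n => A `&` [set y | c + e <= g n y]).
  - by move=> n; exists [set y | c + e <= g n y] => //; exact: closed_superlevel.
  - by move=> n y [Ay /= h1]; split => //=; apply: le_trans h1 (gd _ _ _ _ Ay).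
  - exact: h.
  - have Ay : A y by have [] := yK 0%N I.
    have cey N : c + e <= g N y by have [_] := yK N I.
    have vym : v y = m.
      apply/eqP; rewrite eq_le -subr_le0 vm//= leNgt; apply/negP => vym.
      have mv0 : 0 < m - v y by rewrite subr_gt0.
      have := @archi_boundP R (`|u y - c| / (m - v y)).
      rewrite divr_ge0// ?ltW// => /(_ isT); set N := Num.bound _.
      rewrite ltr_pdivrMr// => h1.
      have := cey N; rewrite /g -[v y - m]opprB mulrN => h2.
      by have := ler_norm (u y - c); lra.
    have yargmax : argmax v A y.
      by split => // z Az; rewrite vym le_sup_image.
    have := cey 0%N; rewrite /g mul0r addr0 leNgt => /negP; apply.
    by rewrite (le_lt_trans (le_sup_image cu cargmax yargmax))// ltrDl.
near=> N.
have h1 := sup_penalized_ge N.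
rewrite distrC ger0_norm ?subr_ge0// ltrBlDl ltNge; apply/negP => ey.
have [y Ay yE] := sup_image_attained (@cw N) cA A0.
apply: n0P; exists y; split => //=.
apply: le_trans (gd n0 N _ _ Ay); last by near: N; exact: nbhs_infty_ge.
by move: ey; rewrite yE /w /g mulrBr addrA.
Unshelve. all: by end_near. Qed.

End penalized.

End sup_image.

Section support.
Context {R : realType} {X : ptopologicalType}.
Local Notation Omega := (path_space R X).
Implicit Types (P Q : law R Omega) (f : Omega -> R) (s : time R).

Lemma evaluation_bounded_measurable (g : X -> R) s :
  @bounded_measurable _ (borel X) R g ->
  @bounded_measurable _ (borel Omega) R (fun w => g ((w : Omega) s)).
Proof.
move=> [mg [B gB]]; split; last by exists B.
have me : measurable_fun [set: borel Omega]
    ((fun w : Omega => w s) : borel Omega -> borel X).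
  by apply: continuous_borel_measurable_map; exact: evaluation_continuous.
exact: (measurableT_comp mg me).
Qed.

Lemma law_mean_bounded P f B : @bounded_measurable _ (borel Omega) R f ->
  (forall w, `|f w| <= B) -> `|law_mean P f| <= B.
Proof. by move=> [mf _] fB; exact: (@mean_bounded _ (borel Omega) R (law_prob P)). Qed.

Section support_fun.
Variable K : X -> set (law R Omega).
Hypotheses (cK : forall x, compact (K x)) (K0 : forall x, K x !=set0).
Hypothesis mK : @hit_measurable _ (borel X) _ K.

Lemma le_support_fun x P f : Cb f -> K x P -> law_mean P f <= support_fun K x f.
Proof.
by move=> fCb KP; apply: (@le_sup_image _ _ _ (fun P => law_mean P f)) => //;
  exact: law_mean_continuous.
Qed.

Lemma support_fun_attained x f : Cb f ->
  exists2 P, K x P & support_fun K x f = law_mean P f.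
Proof.
by move=> fCb; apply: (@sup_image_attained _ _ _ (fun P => law_mean P f)) => //;
  exact: law_mean_continuous.
Qed.

Lemma support_fun_bounded x f B : Cb f -> (forall w, `|f w| <= B) ->
  `|support_fun K x f| <= B.
Proof.
move=> fCb fB; have [P _ ->] := support_fun_attained x fCb.
by apply: law_mean_bounded => //; exact: Cb_bounded_measurable.
Qed.

Lemma support_fun_bounded_measurable f : Cb f ->
  @bounded_measurable _ (borel X) R (fun x => support_fun K x f).
Proof.
move=> fCb; split.
  apply: (@measurable_fun_sup_image _ _ _ (borel X) K (fun P => law_mean P f)) => //.
  exact: law_mean_continuous.
by have /CbP[_ [B fB]] := fCb; exists B => x; exact: support_fun_bounded.
Qed.

Lemma support_fun_evaluation_bounded_measurable s f : Cb f ->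
  @bounded_measurable _ (borel Omega) R (fun w => support_fun K ((w : Omega) s) f).
Proof.
by move=> fCb; exact: evaluation_bounded_measurable (support_fun_bounded_measurable fCb).
Qed.

End support_fun.

(** The relation that defines [Kset], read as a property of [K]: the induction shrinks [K] while [P]
    and [Q] stay fixed. *)
Definition dominated_by_support (K : X -> set (law R Omega)) P Q s :=
  forall f, Cb f -> law_mean Q f <= law_mean P (fun w => support_fun K (w s) f).

(* Subtracting [N] times the equality for [F] from the bound for [f + N F] and
   letting [N] tend to infinity replaces the supremum over [K] by the supremum over the
   maximizers of [F] in [K]. *)
Lemma dominated_by_support_argmax (K : X -> set (law R Omega)) P Q s F : Cb F ->
  (forall x, compact (K x)) -> (forall x, K x !=set0) ->
  @hit_measurable _ (borel X) _ K ->
  dominated_by_support K P Q s ->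
  law_mean Q F = law_mean P (fun w => support_fun K (w s) F) ->
  dominated_by_support (fun x => argmax (fun P => law_mean P F) (K x)) P Q s.
Proof.
move=> FCb cK K0 mK KPQ QF f fCb.
have /CbP[_ [B fB]] := fCb.
have cf := law_mean_continuous fCb; have cF := law_mean_continuous FCb.
pose fN (N : nat) := fun w => f w + N%:R * F w.
have fNCb N : Cb (fN N) by apply: CbD => //; exact: CbZ.
pose g (N : nat) x := support_fun K x (fN N) - N%:R * support_fun K x F.
have bmf := Cb_bounded_measurable fCb; have bmF := Cb_bounded_measurable FCb.
have law_meanfN (P' : law R Omega) N :
    law_mean P' (fN N) = law_mean P' f + N%:R * law_mean P' F.
  by rewrite /law_mean /fN meanD ?meanZ//; exact: bounded_measurableZ.
have gE N x : g N x = sup ((fun P' => law_mean P' f + N%:R * law_mean P' F) @` K x) -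
    N%:R * sup ((fun P' => law_mean P' F) @` K x).
  rewrite /g /support_fun; congr (sup (_ @` _) - _).
  by apply/funext => P'; exact: law_meanfN.
have gub N x : `|g N x| <= B.
  have K'0 : argmax (fun P => law_mean P F) (K x) !=set0 by exact: argmax_nonempty.
  have cK' : compact (argmax (fun P => law_mean P F) (K x)).
    apply: closed_in_compact (cK x) _; apply: argmax_closed_in => //.
    by exists setT => //; rewrite setIT.
  rewrite ler_norml gE; apply/andP; split.
    apply: le_trans (sup_penalized_ge cf cF (cK x) (K0 x) N).
    have [P' _ ->] := sup_image_attained cf cK' K'0.
    have : `|law_mean P' f| <= B by exact: law_mean_bounded.
    by rewrite ler_norml => /andP[].
  apply: le_trans (sup_penalized_le cf cF (cK x) (K0 x) N) _.
  exact: le_trans (ler_norm _) (support_fun_bounded cK K0 x fCb fB).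
have bmN N := support_fun_evaluation_bounded_measurable cK K0 mK s (fNCb N).
have bmNF := support_fun_evaluation_bounded_measurable cK K0 mK s FCb.
have bmg N : @bounded_measurable _ (borel Omega) R (fun w => g N ((w : Omega) s)).
  apply: bounded_measurableD => //.
  by apply: bounded_measurableN; exact: bounded_measurableZ.
have gP : law_mean P (fun w => g N (w s)) @[N --> \oo] -->
    law_mean P (fun w => support_fun
      (fun x => argmax (fun P => law_mean P F) (K x)) (w s) f).
  apply: (@mean_cvg _ (borel Omega) R (law_prob P)
    (fun N w => g N ((w : Omega) s)) _ B).
  - by move=> N; have [] := bmg N.
  - by move=> N w; exact: gub.
  - by move=> w; under eq_fun do rewrite gE; exact: sup_penalized_cvg.
have fg N : law_mean Q f <= law_mean P (fun w => g N (w s)).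
  have := KPQ _ (fNCb N); rewrite law_meanfN QF -lerBrDr => h.
  apply: (le_trans h).
  rewrite /law_mean /g meanD//; last first.
    by apply: bounded_measurableN; exact: bounded_measurableZ.
  by rewrite meanN ?meanZ//; exact: bounded_measurableZ.
by apply: (cvgr_to_ge gP); near=> N; exact: fg.
Unshelve. all: by end_near. Qed.

End support.

(** * Krylov maps *)

Section selection.
Context {R : realType} {X : ptopologicalType} (phi : nat -> X -> R).
Hypothesis phi_Cb : forall n, Cb (phi n).
Hypothesis phi_sep : strongly_separates_points (range phi).
Local Notation Omega := (path_space R X).
Implicit Types (P Q : law R Omega) (s : time R).

(** Maximizing the means of all cylinder functions in turn leaves a single law, since these means
    determine it. For a single-valued map, meeting a closed set says that the selected law belongs
    to it, so measurability of the map is that of the selection. *)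
Lemma measurable_selection_exists (K : X -> set (law R Omega)) :
  (forall x, compact (K x)) -> (forall x, K x !=set0) ->
  @hit_measurable _ (borel X) _ K -> exists p, measurable_selection K p.
Proof.
move=> cK K0 mK.
(* A code that decodes to no list stands for the empty product, the constant 1, whose mean discards
   no law. *)
pose M k := fun P : law R Omega =>
  law_mean P (cylinder phi (odflt [::] (unpickle k))).
have cM k : continuous (M k) by exact/law_mean_continuous/cylinder_Cb.
pose D x := lexmax_inf M (K x).
have mD : @hit_measurable _ (borel X) _ D by exact: hit_measurable_lexmax_inf.
have D1 x P Q : D x P -> D x Q -> P = Q.
  move=> DP DQ; apply: (law_eq_cylinder phi_Cb phi_sep) => L.
  by have := lexmax_inf_eq (pickle L) DP DQ; rewrite /M pickleK.
have /choice[p pD] x : exists P, D x P.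
  by have [P DP] := lexmax_inf_nonempty cM (cK x) (K0 x); exists P.
exists p; split; last by move=> x; exact: lexmax_inf_sub (pD x).
apply: (@measurability _ _ (borel X) (borel (law R Omega)) setT p (@open (law R Omega))) => //.
move=> _ [U oU <-]; rewrite setTI.
rewrite -[X in measurable X]setCK; apply: measurableC.
rewrite (_ : ~` _ = [set x | D x `&` ~` U !=set0]).
  by apply: mD; exact: open_closedC.
apply/seteqP; split=> x /=; first by move=> pU; exists (p x).
by move=> [P [DP nUP]] pU; apply: nUP; rewrite (D1 _ _ _ DP (pD x)).
Qed.

Lemma selection_mean_measurable (p : X -> law R Omega) f :
  measurable_fun [set: borel X] (p : borel X -> borel (law R Omega)) -> Cb f ->
  measurable_fun [set: borel X] ((fun x => law_mean (p x) f) : borel X -> R).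
Proof.
move=> mp fCb.
have mf : measurable_fun [set: borel (law R Omega)]
    ((fun P => law_mean P f) : borel (law R Omega) -> R).
  by apply: continuous_borel_measurable; exact: law_mean_continuous.
exact: (measurableT_comp mf mp).
Qed.

Lemma selection_kernel_measurable (p : X -> law R Omega) (A : set (borel Omega)) :
  measurable_fun [set: borel X] (p : borel X -> borel (law R Omega)) ->
  measurable A -> measurable_fun [set: borel X] ((fun x => p x A) : borel X -> \bar R).
Proof.
move=> mp mA.
apply: (@kernel_measurable_cylinder _ _ _ phi_Cb phi_sep _ (borel X) p) => // L.
by apply: selection_mean_measurable => //; exact: cylinder_Cb.
Qed.

Lemma selection_mixture (p : X -> law R Omega) P s :
  measurable_fun [set: borel X] (p : borel X -> borel (law R Omega)) ->
  exists Q : law R Omega,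
    (forall A : set (borel Omega), measurable A ->
      Q A = (\int[P]_w p ((w : Omega) s) A)%E) /\
    (forall f, Cb f -> law_mean Q f = law_mean P (fun w => law_mean (p (w s)) f)).
Proof.
move=> mp.
have mps (A : set (borel Omega)) : measurable A ->
    measurable_fun [set: borel Omega] ((fun w => p ((w : Omega) s) A) : borel Omega -> \bar R).
  move=> mA.
  have me : measurable_fun [set: borel Omega]
      ((fun w : Omega => w s) : borel Omega -> borel X).
    by apply: continuous_borel_measurable_map; exact: evaluation_continuous.
  exact: (measurableT_comp (selection_kernel_measurable mp mA) me).
have [Q [QA Qf]] := @mixture_exists _ _ (borel Omega) (borel Omega) R (law_prob P)
  (fun w => law_prob (p ((w : Omega) s))) mps.
exists (law_of Q); split => [A mA|f fCb].
  by rewrite -QA//; exact: borel_partE.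
rewrite /law_mean -Qf; last exact: Cb_bounded_measurable.
by apply: eq_probability_mean => A mA; exact: borel_partE.
Qed.

End selection.

Section krylov.
Context {R : realType} {X : ptopologicalType}.
Context (lam : nat -> R) (phi : nat -> X -> R).
Variable C : X -> set (law R (path_space R X)).
Hypothesis phi_Cb : forall n, Cb (phi n).
Hypothesis phi_sep : strongly_separates_points (range phi).
Hypothesis lam_gt0 : forall n, 0 < lam n.
Hypothesis krylov_C : krylov_map lam phi C.
Local Notation Omega := (path_space R X).
Implicit Types (P Q : law R Omega) (s : time R) (x : X).

Let F n := path_laplace (R := R) (phi n) (lam n).
Let L n P := law_mean P (F n).

Let FCb n : Cb (F n). Proof. exact: path_laplace_Cb. Qed.

Let cL n : continuous (L n). Proof. exact/law_mean_continuous/FCb. Qed.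

Let cC x : compact (C x). Proof. by have [] := krylov_C1 krylov_C x. Qed.
Let C0 x : C x !=set0. Proof. by have [] := krylov_C1 krylov_C x. Qed.
Let mC : @hit_measurable _ (borel X) _ C. Proof. exact: krylov_C2 krylov_C. Qed.

Definition laplace_lexmax n x := lexmax L (C x) n.

Definition laplace_lexmax_inf x := lexmax_inf L (C x).

Let cCn n x : compact (laplace_lexmax n x). Proof. exact: lexmax_compact. Qed.
Let Cn0 n x : laplace_lexmax n x !=set0. Proof. exact: lexmax_nonempty. Qed.
Let mCn n : @hit_measurable _ (borel X) _ (laplace_lexmax n).
Proof. exact: hit_measurable_lexmax. Qed.
Let cCI x : compact (laplace_lexmax_inf x). Proof. exact: lexmax_inf_compact. Qed.
Let CI0 x : laplace_lexmax_inf x !=set0. Proof. exact: lexmax_inf_nonempty. Qed.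
Let mCI : @hit_measurable _ (borel X) _ laplace_lexmax_inf.
Proof. exact: hit_measurable_lexmax_inf. Qed.

(* (KP2) applied to the mixture of a measurable selection of lexicographic
   maximizers yields a competitor [Q] of [P] which keeps up with [P] in each
   coordinate, so that [P] and [Q] stay tied and (KP1) passes to the maximizers. *)
Lemma laplace_lexmax_dominated x s P n : 0 < \val s -> laplace_lexmax_inf x P ->
  dominated_by_support (laplace_lexmax n) P (shift_law s P) s.
Proof.
move=> s0 PI.
have [p [mp pCI]] := measurable_selection_exists phi_Cb phi_sep cCI CI0 mCI.
have [Q' [_ Q'f]] := selection_mixture phi_Cb phi_sep P s mp.
have CP : C x P by exact: lexmax_inf_sub PI.
have pbm f : Cb f -> @bounded_measurable _ (borel Omega) R
    (fun w => law_mean (p ((w : Omega) s)) f).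
  move=> fCb; apply: (@evaluation_bounded_measurable _ _ (fun x => law_mean (p x) f)).
  split; first exact: selection_mean_measurable.
  have /CbP[_ [B fB]] := fCb; exists B => y.
  by apply: law_mean_bounded => //; exact: Cb_bounded_measurable.
have Q'K : Kset P s C Q'.
  move=> f fCb; rewrite Q'f//; apply: (@le_mean _ (borel Omega) R (law_prob P)).
  - exact: pbm.
  - exact: support_fun_evaluation_bounded_measurable.
  - move=> w; apply: le_support_fun => //.
    by apply: (lexmax_inf_sub (l := L)); exact: pCI.
have [Q [CQ _ Qzeta] QQ'] : (shift_law s @` Gammaset lam phi P x s C) Q'.
  by rewrite (krylov_KP2 krylov_C s0 CP).
have L_zeta m P' : L m P' = zeta (lam m) (phi m) s P' +
    expR (- lam m * \val s) * law_mean (shift_law s P') (F m).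
  exact: law_mean_path_laplace_zeta.
suff : laplace_lexmax n x Q /\
    dominated_by_support (laplace_lexmax n) P (shift_law s P) s by case.
elim: n => [|n [Qn Pn]]; first by split => //; exact: krylov_KP1 krylov_C x s P s0 CP.
(* The selected law lies in every stage, so it realizes the supremum of coordinate [n] over stage
   [n]; the bound for the shift of [P] thus becomes a comparison with the mixture [Q']. *)
have suppE y : support_fun (laplace_lexmax n) y (F n) = law_mean (p y) (F n).
  apply: (@sup_image_argmax _ _ _ (L n)) => //.
  exact: (pCI y n.+1 I).
have mQ' : law_mean P (fun w => support_fun (laplace_lexmax n) (w s) (F n)) =
    law_mean Q' (F n).
  by rewrite Q'f//; congr (law_mean P _); apply/funext => w; exact: suppE.
have PQ' : law_mean (shift_law s P) (F n) <= law_mean Q' (F n).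
  by rewrite -mQ'; exact: Pn.
have [Pn1 Pmax] := PI n.+1 I.
have LQP : L n Q <= L n P by exact: Pmax.
have e0 : 0 < expR (- lam n * \val s) by exact: expR_gt0.
(* [Q] is still in stage [n], so maximality of [P] gives [L n Q <= L n P]. As [Q] is at least as
   good as [P] on [[0, s]], its future [Q'] cannot be better than the shift of [P]. *)
have Q'P : law_mean Q' (F n) <= law_mean (shift_law s P) (F n).
  move: LQP; rewrite !L_zeta QQ' => LQP.
  rewrite -(ler_pM2l e0) -(lerD2l (zeta (lam n) (phi n) s Q)).
  by apply: (le_trans LQP); rewrite lerD2r.
split.
  (* Conversely [Q] is at least as good as [P] both before and after [s], so it is a maximizer too;
     this invariant allows the comparison at the next coordinate. *)
  split => // P' P'n; apply: (le_trans (Pmax _ P'n)).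
  by rewrite !L_zeta QQ' lerD// ler_pM2l.
apply: (@dominated_by_support_argmax _ _ (laplace_lexmax n)) => //.
transitivity (law_mean Q' (F n)); last exact/esym.
by apply/eqP; rewrite eq_le PQ'.
Qed.

(** By compactness the support functions of the nested stages converge boundedly to that of their
    intersection. *)
Lemma laplace_lexmax_inf_dominated x s P : 0 < \val s -> laplace_lexmax_inf x P ->
  dominated_by_support laplace_lexmax_inf P (shift_law s P) s.
Proof.
move=> s0 PI f fCb; have /CbP[_ [B fB]] := fCb.
have cvgn : law_mean P (fun w => support_fun (laplace_lexmax n) (w s) f) @[n --> \oo] -->
    law_mean P (fun w => support_fun laplace_lexmax_inf (w s) f).
  apply: (@mean_cvg _ (borel Omega) R (law_prob P)
    (fun n w => support_fun (laplace_lexmax n) ((w : Omega) s) f) _ B).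
  - move=> n.
    by have [] := support_fun_evaluation_bounded_measurable
      (@cCn n) (@Cn0 n) (@mCn n) s fCb.
  - by move=> n w; exact: support_fun_bounded.
  - move=> w; apply: (sup_image_nested_cvg (law_mean_continuous fCb) (@cC (w s))).
    + by move=> n; exact: lexmax_closed_in.
    + by move=> n; exact: lexmax_decr.
    + by move=> n; exact: lexmax_nonempty.
apply: (cvgr_to_ge cvgn); near=> n.
exact: laplace_lexmax_dominated PI _ fCb.
Unshelve. all: by end_near. Qed.

End krylov.

(** * One-dimensional marginals and the starting point *)

Section one_dimensional_laws.
Context {R : realType} {X : ptopologicalType}.
Local Notation Omega := (path_space R X).
Implicit Types (P Q : law R Omega) (s t : time R) (x : X).

Definition borel_evaluation t : borel Omega -> borel X := fun w => (w : Omega) t.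

Lemma borel_evaluation_measurable t : measurable_fun setT (borel_evaluation t).
Proof. by apply: continuous_borel_measurable_map; exact: evaluation_continuous. Qed.

HB.instance Definition _ t :=
  isMeasurableFun.Build _ _ _ _ (borel_evaluation t) (borel_evaluation_measurable t).

Lemma mean_distribution_evaluation P t (g : X -> R) :
  @bounded_measurable _ (borel X) R g ->
  \int[distribution P (borel_evaluation t)]_x g x = law_mean P (fun w => g (w t)).
Proof.
move=> bg; rewrite /law_mean /Rintegral; congr fine.
rewrite integral_pushforward//=; first by apply/measurable_EFinP; case: bg.
apply: (@bounded_measurable_integrable _ _ _ (law_prob P) (fun w => g ((w : Omega) t))).
exact: evaluation_bounded_measurable.
Qed.

(** Equality is needed for Borel [g]: it is applied to support functions, which (C2) makes
    measurable but which need not be continuous in the starting point. *)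
Lemma law_mean_evaluation_eq (phi : nat -> X -> R) P Q t :
  (forall n, Cb (phi n)) -> strongly_separates_points (range phi) ->
  (forall f g, range phi f -> range phi g -> range phi (f \* g)) ->
  (forall n, law_mean P (fun w => phi n (w t)) = law_mean Q (fun w => phi n (w t))) ->
  forall g : X -> R, @bounded_measurable _ (borel X) R g ->
  law_mean P (fun w => g (w t)) = law_mean Q (fun w => g (w t)).
Proof.
move=> phi_Cb phi_sep phi_mul PQ g bg.
have phi_bm : range phi `<=` @bounded_measurable _ (borel X) R.
  by move=> _ [n _ <-]; exact: Cb_bounded_measurable.
rewrite -!mean_distribution_evaluation//; apply: eq_probability_mean.
apply: (@determining_class_eq _ (borel X) R (range phi) phi_bm phi_mul).
  by apply: borel_generated_by_separating => // n; have /CbP[] := phi_Cb n.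
move=> _ [n _ <-]; rewrite !mean_distribution_evaluation//.
all: exact: Cb_bounded_measurable.
Qed.

Lemma law_mean_start P x f g : P [set w | (w : Omega) (to_time 0) = x] = 1%E ->
  @bounded_measurable _ (borel Omega) R f -> @bounded_measurable _ (borel Omega) R g ->
  (forall w : Omega, w (to_time 0) = x -> f w = g w) -> law_mean P f = law_mean P g.
Proof.
move=> P1 [mf _] [mg _] fg; set A := [set w | _] in P1.
(* non-measurable sets have probability 0 under a [law] *)
have mA : measurable (A : set (borel Omega)).
  by apply: contrapT => /(law_out P); rewrite P1 => /eqP; rewrite onee_eq0.
rewrite /law_mean /Rintegral; congr fine; apply: ae_eq_integral => //.
- exact/measurable_EFinP.
- exact/measurable_EFinP.
exists (~` (A : set (borel Omega))); split.
- exact: measurableC.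
- by rewrite [LHS]probability_setC// P1 subee.
- by move=> w /= nfg Aw; apply: nfg => _; rewrite fg.
Qed.

End one_dimensional_laws.

(** * Uniqueness of the maximizer and the Markov property *)

Section uniqueness.
Context {R : realType} {X : ptopologicalType}.
Context (Lambda : set R) (lam : nat -> R) (phi : nat -> X -> R).
Variable C : X -> set (law R (path_space R X)).
Hypothesis phi_Cb : forall n, Cb (phi n).
Hypothesis phi_sep : strongly_separates_points (range phi).
Hypothesis phi_mul : forall f g, range phi f -> range phi g -> range phi (f \* g).
Hypothesis Lambda_pos : Lambda `<=` `]0, +oo[%classic.
Hypothesis Lambda_dense : `]0, +oo[%classic `<=` closure Lambda.
Hypothesis lam_phi_enum :
  range (fun n => (lam n, phi n)) = Lambda `*` range phi.
Hypothesis krylov_C : krylov_map lam phi C.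
Local Notation Omega := (path_space R X).
Implicit Types (P Q : law R Omega) (s t : time R) (x : X).

Let lam_gt0 n : 0 < lam n.
Proof.
have : (Lambda `*` range phi) (lam n, phi n) by rewrite -lam_phi_enum; exists n.
by move=> [/= /Lambda_pos + _]; rewrite /= in_itv/= andbT.
Qed.

Local Notation CI := (laplace_lexmax_inf lam phi C).

Let cC x : compact (C x). Proof. by have [] := krylov_C1 krylov_C x. Qed.
Let C0 x : C x !=set0. Proof. by have [] := krylov_C1 krylov_C x. Qed.

Let cL n : continuous (fun P => law_mean P (path_laplace (R := R) (phi n) (lam n))).
Proof. exact/law_mean_continuous/path_laplace_Cb. Qed.

Let cCI x : compact (CI x). Proof. exact: lexmax_inf_compact. Qed.
Let CI0 x : CI x !=set0. Proof. exact: lexmax_inf_nonempty. Qed.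
Let mCI : @hit_measurable _ (borel X) _ CI.
Proof. by apply: hit_measurable_lexmax_inf => //; exact: krylov_C2 krylov_C. Qed.

Lemma laplace_lexmax_inf_marginal x P Q t (g : X -> R) : CI x P -> CI x Q ->
  @bounded_measurable _ (borel X) R g ->
  law_mean P (fun w => g (w t)) = law_mean Q (fun w => g (w t)).
Proof.
move=> PI QI; apply: law_mean_evaluation_eq => // n.
suff : marginal (phi n) P (\val t) = marginal (phi n) Q (\val t).
  by rewrite /marginal to_time_val.
apply: (marginal_unique (phi_Cb n) Lambda_pos Lambda_dense); last exact: time_ge0.
move=> l Ll.
have [m _ [<- <-]] : range (fun n => (lam n, phi n)) (l, phi n).
  by rewrite lam_phi_enum; split => //; exists n.
exact: lexmax_inf_eq m PI QI.
Qed.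

Let support_mean x P f : Cb f ->
  (forall Q, CI x Q -> law_mean Q f = law_mean P f) -> support_fun CI x f = law_mean P f.
Proof. by move=> fCb h; have [Q QI ->] := support_fun_attained cCI CI0 x fCb; exact: h. Qed.

(** When the laws of each [CI y] give [f] a common mean, the support function of [- f] is minus that
    of [f], so the bounds for [f] and [- f] are opposite inequalities. *)
Lemma laplace_lexmax_inf_shift x P s f : 0 < \val s -> CI x P -> Cb f ->
  (forall y P' Q', CI y P' -> CI y Q' -> law_mean P' f = law_mean Q' f) ->
  law_mean (shift_law s P) f = law_mean P (fun w => support_fun CI (w s) f).
Proof.
move=> s0 PI fCb fCI; apply/eqP; rewrite eq_le; apply/andP; split.
  exact: (laplace_lexmax_inf_dominated phi_Cb phi_sep lam_gt0 krylov_C s0 PI fCb).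
have := laplace_lexmax_inf_dominated phi_Cb phi_sep lam_gt0 krylov_C s0 PI (CbN fCb).
have bmf := support_fun_evaluation_bounded_measurable cCI CI0 mCI s fCb.
rewrite {1}/law_mean meanN; last exact: Cb_bounded_measurable.
rewrite lerNl; apply: le_trans; rewrite le_eqVlt; apply/orP; left; apply/eqP.
rewrite /law_mean -meanN; last first.
  exact: (support_fun_evaluation_bounded_measurable cCI CI0 mCI s (CbN fCb)).
congr (Rintegral _ _ _); apply/funext => w.
have [P' P'I ->] := support_fun_attained cCI CI0 (w s) fCb.
have [Q' Q'I ->] := support_fun_attained cCI CI0 (w s) (CbN fCb).
rewrite /law_mean meanN ?opprK; last exact: Cb_bounded_measurable.
exact: fCI P'I Q'I.
Qed.

Let le_time (i j : rat * nat) := i.1 <= j.1.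

Let le_time_trans : transitive le_time. Proof. by move=> i j k; exact: le_trans. Qed.

(** Induction on the number of times. A shift by the first time leaves a factor at time 0, constant
    by (C3), times a shorter cylinder, whose mean is common to all laws of one [CI y]. The shift
    bound is then an equality, and its right-hand side is the mean of a function of [w s] alone, on
    which [P] and [Q] agree. *)
Lemma laplace_lexmax_inf_sorted_cylinder (L : seq (rat * nat)) x P Q :
  sorted le_time L -> (forall i, i \in L -> 0 <= i.1) -> CI x P -> CI x Q ->
  law_mean P (cylinder phi L) = law_mean Q (cylinder phi L).
Proof.
have [k] := ubnP (size L); elim: k L x P Q => // k IHk [|[t n] L] x P Q /=.
  move=> _ _ _ _ _; rewrite (_ : cylinder phi [::] = fun=> 1); last first.
    by apply/funext => w; rewrite /cylinder big_nil.
  by rewrite /law_mean !mean_cst.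
rewrite ltnS => Lk Ls L0 PI QI.
pose L1 := [seq (i.1 - t, i.2) | i <- L].
have tL i : i \in L -> t <= i.1.
  by move=> iL; have /allP/(_ _ iL) := order_path_min le_time_trans Ls.
have startE y P' Q' : CI y P' -> CI y Q' ->
    law_mean P' (cylinder phi ((0, n) :: L1)) = law_mean Q' (cylinder phi ((0, n) :: L1)).
  have h P'' : CI y P'' -> law_mean P'' (cylinder phi ((0, n) :: L1)) =
      phi n y * law_mean P'' (cylinder phi L1).
    move=> P''I; have /(krylov_C3 krylov_C) P''1 : C y P'' by exact: lexmax_inf_sub P''I.
    have bL1 := Cb_bounded_measurable (cylinder_Cb phi_Cb L1).
    rewrite /law_mean -meanZ//; apply: law_mean_start P''1 _ _ _.
    - exact/Cb_bounded_measurable/cylinder_Cb.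
    - exact: bounded_measurableZ.
    - by move=> w wy; rewrite /cylinder big_cons /= rmorph0 wy.
  move=> P'I Q'I; rewrite !h//; congr (_ * _); apply: IHk P'I Q'I.
  - by rewrite size_map.
  - apply: (@homo_sorted _ _ (fun i : rat * nat => (i.1 - t, i.2)) le_time) => //.
      by move=> i j; rewrite /le_time /= lerD2r.
    exact: path_sorted Ls.
  - by move=> _ /mapP[i iL ->] /=; rewrite subr_ge0 tL.
have : 0 <= t by exact: (L0 (t, n) (mem_head _ _)).
(* A first time equal to 0 is treated apart, because (KP1) and (KP2) concern positive shifts. *)
rewrite le_eqVlt => /predU1P[t0|t0].
  have LE : (t, n) :: L = (0, n) :: L1.
    rewrite -t0 /L1; congr (_ :: _); rewrite -[LHS]map_id; apply: eq_map => -[u m] /=.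
    by rewrite -t0 subr0.
  by rewrite LE; exact: startE PI QI.
pose s := to_time (ratr t : R).
have s0 : 0 < \val s by rewrite /= lt_max ltr0q t0 orbT.
have fCb := cylinder_Cb (R := R) phi_Cb ((0, n) :: L1).
have shiftL P' : law_mean P' (cylinder phi ((t, n) :: L)) =
    law_mean (shift_law s P') (cylinder phi ((0, n) :: L1)).
  rewrite law_mean_shift; last exact: Cb_bounded_measurable.
  congr (law_mean _ _); apply/funext => w.
  have wE (u : rat) : 0 <= u ->
      shift_path s w (to_time (ratr u)) = w (to_time (ratr (t + u))).
    move=> u0; transitivity (w (time_add s (to_time (ratr u)))) => //.
    rewrite /time_add /= !max_r ?ler0q//; last exact: ltW.
    by rewrite rmorphD.
  rewrite /cylinder !big_cons /L1 big_map; congr (_ * _).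
    transitivity (phi n (shift_path s w (to_time (ratr 0)))) => //.
    by rewrite wE// addr0.
  rewrite big_seq [RHS]big_seq; apply: eq_bigr => i iL.
  transitivity (phi i.2 (shift_path s w (to_time (ratr (i.1 - t))))) => //.
  rewrite wE; last by rewrite subr_ge0; exact: tL.
  by rewrite [t + _]addrC subrK.
rewrite !shiftL !(laplace_lexmax_inf_shift (x := x) s0)//.
apply: (@laplace_lexmax_inf_marginal x P Q s
  (fun y => support_fun CI y (cylinder phi ((0, n) :: L1)))) => //.
exact: support_fun_bounded_measurable.
Qed.

Lemma laplace_lexmax_inf_unique x P Q : CI x P -> CI x Q -> P = Q.
Proof.
move=> PI QI; apply: (law_eq_cylinder phi_Cb phi_sep) => L.
(* Neither operation changes the function: [to_time] already reads negative times as 0, and the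
   product ignores the order of its factors. *)
pose L' := sort le_time [seq (Num.max 0 i.1, i.2) | i <- L].
have -> : cylinder phi L = cylinder (R := R) phi L'.
  apply/funext => w; rewrite /cylinder /L'.
  rewrite [RHS](perm_big _ (permEl (perm_sort _ _))) big_map.
  apply: eq_bigr => i _ /=; congr (phi _ (w _)).
  have [i0|i0] := leP 0 i.1; first by [].
  by apply: eq_exist; rewrite rmorph0 /= maxxx max_l// ltW// ltrq0.
apply: laplace_lexmax_inf_sorted_cylinder PI QI.
  by apply: sort_sorted => i j; exact: le_total.
by move=> i; rewrite mem_sort => /mapP[j _ ->] /=; rewrite le_max lexx.
Qed.

Theorem krylov_markov_selection :
  exists p, measurable_selection C p /\ markov_family p.
Proof.
have [p [mp pCI]] := measurable_selection_exists phi_Cb phi_sep cCI CI0 mCI.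
exists p; split; first by split => // x; exact: lexmax_inf_sub (pCI x).
move=> x s s0 A mA.
have [Q [<-// Qf]] := selection_mixture phi_Cb phi_sep (p x) s mp.
suff -> : shift_law s (p x) = Q by [].
apply: (law_eq_cylinder phi_Cb phi_sep) => L.
have fCb := cylinder_Cb (R := R) phi_Cb L.
rewrite Qf// (laplace_lexmax_inf_shift s0 (pCI x) fCb); last first.
  by move=> y P' Q' P'I Q'I; rewrite (laplace_lexmax_inf_unique P'I Q'I).
congr (law_mean _ _); apply/funext => w; apply: support_mean => // P' P'I.
by rewrite (laplace_lexmax_inf_unique P'I (pCI (w s))).
Qed.

End uniqueness.

Theorem theorem12 (R : realType) (X : ptopologicalType)
    (Phi : set (X -> R)) (Lambda : set R)
    (lam : nat -> R) (phi : nat -> X -> R)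
    (polish_X : polish R X)
    (Phi_countable : countable Phi)
    (Phi_Cb : Phi `<=` @Cb R X)
    (Phi_mul : forall f g : X -> R, Phi f -> Phi g -> Phi (f \* g))
    (Phi_sep : strongly_separates_points Phi)
    (Lambda_countable : countable Lambda)
    (Lambda_pos : Lambda `<=` `]0, +oo[%classic)
    (Lambda_dense : `]0, +oo[%classic `<=` closure Lambda)
    (lam_phi_enum : range (fun n => (lam n, phi n)) = Lambda `*` Phi)
    (C : X -> set (law R (path_space R X)))
    (krylov_C : krylov_map lam phi C) :
  exists p : X -> law R (path_space R X),
    measurable_selection C p /\ markov_family p.
Proof.
(* A point of [Lambda] is needed to recover [Phi] as the range of [phi] from an enumeration of the
   product. *)
have [l Ll] : Lambda !=set0.
  have : closure Lambda 1 by apply: Lambda_dense; rewrite /= in_itv/= ltr01.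
  by move=> /(_ setT filterT)[l [Ll _]]; exists l.
have PhiE : Phi = range phi.
  apply/seteqP; split => [f Phif|_ [n _ <-]].
    have [n _ [_ <-]] : range (fun n => (lam n, phi n)) (l, f) by rewrite lam_phi_enum.
    by exists n.
  have : (Lambda `*` Phi) (lam n, phi n) by rewrite -lam_phi_enum; exists n.
  by case.
rewrite {}PhiE in Phi_Cb Phi_mul Phi_sep lam_phi_enum *.
apply: (krylov_markov_selection _ Phi_sep Phi_mul Lambda_pos Lambda_dense
  lam_phi_enum krylov_C) => n.
by apply: Phi_Cb; exists n.
Qed.
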